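(* Let $(E,h^E)$ be a Hermitian holomorphic vector bundle of rank $r$ over a complex manifold $X$ of dimension $n$. (1) $(E,h^E)$ is strongly decomposably non-negative of type I if and only if for every $x\in X$ there exist, with respect to a unitary frame of $E_x$, an $r\times N_2$ matrix $B$ with $(0,1)$-forms at $x$ as entries and an $r\times N_1$ matrix $A$ with $(1,0)$-forms at $x$ as entries (for some $N_1,N_2\in\mathbb{N}$) such that the Chern curvature matrix at $x$ satisfies $$R=-B\wedge\overline{B}^\top+A\wedge\overline{A}^\top\qquad\text{and}\qquad \mathrm{span}_{\mathbb{C}}\{\overline{B}\}\cap\mathrm{span}_{\mathbb{C}}\{A\}=\{0\}.$$ (2) $(E,h^E)$ is strongly decomposably positive of type I if and only if for every $x\in X$ there exist, with respect to a unitary frame of $E_x$, matrices $B$ and $A$ as in (1) satisfying the two displayed conditions, and a decomposition $T^{1,0}_xX=U_x\oplus V_x$ such that the entries of $B$ lie in $\overline{U_x^*}$, the entries of $A$ lie in $V_x^*$, and $$\mathrm{rank}(\mathbf{A})=r\dim V_x,\qquad \mathrm{rank}(\mathbf{B})=r\dim U_x.$$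
   Context: Curvature. $R^E$ is the Chern curvature of $(E,h^E)$. For a local holomorphic frame $\{e_i\}_{1\le i\le r}$ of $E$ and local holomorphic coordinates $\{z^\alpha\}_{1\le\alpha\le n}$, with $h_{i\bar j}=h^E(e_i,e_j)$, $\partial_\alpha=\partial/\partial z^\alpha$, $\partial_{\bar\beta}=\partial/\partial\bar z^\beta$, set $R_{i\bar j\alpha\bar\beta}=-\partial_\alpha\partial_{\bar\beta}h_{i\bar j}+h^{\bar l k}\partial_\alpha h_{i\bar l}\partial_{\bar\beta}h_{k\bar j}$. The curvature matrix is $R=(R^j_i)$ ($j$ row, $i$ column), where $R^E=R^j_i\,e_j\otimes e^i$, $R^j_i=R^j_{i\alpha\bar\beta}dz^\alpha\wedge d\bar z^\beta$ and $R_{i\bar j\alpha\bar\beta}=R^k_{i\alpha\bar\beta}h_{k\bar j}$; in a frame that is unitary at $x$, $R^j_{i\alpha\bar\beta}=R_{i\bar j\alpha\bar\beta}$ at $x$. The Einstein summation convention is used. Type I positivity. $(E,h^E)$ is strongly decomposably positive (resp. non-negative) of type I if for every $x\in X$ there is a direct sum decomposition into complex subspaces $T^{1,0}_xX=U_x\oplus V_x$ (either may be zero) such that $$R_{i\bar j\alpha\bar\beta}u^{i\alpha}\overline{u^{j\beta}}>0\ (\text{resp. }\ge0),\quad R_{i\bar j\alpha\bar\beta}u^{i\alpha}\overline{v'^{j\beta}}=0,\quad R_{i\bar j\alpha\bar\beta}v^{\bar j\alpha}\overline{v^{\bar i\beta}}>0\ (\text{resp. }\ge0)$$ for all non-zero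 $u=u^{i\alpha}e_i\otimes\partial_\alpha\in E_x\otimes U_x$, $v'=v'^{j\beta}e_j\otimes\partial_\beta\in E_x\otimes V_x$, $v=v^{\bar j\alpha}\bar e_j\otimes\partial_\alpha\in\overline{E}_x\otimes V_x$. Matrices of forms. For a matrix $M=(M_{ip})$ of one-forms, $M\wedge\overline M^\top$ is the matrix with $(j,i)$ entry $\sum_p M_{jp}\wedge\overline{M_{ip}}$. $\{\overline B\}=\{\overline{B_{ip}}:1\le i\le r,1\le p\le N_2\}$ and $\{A\}=\{A_{ip}:1\le i\le r,1\le p\le N_1\}$ are the sets of (conjugated, resp. unconjugated) entries, viewed in $(T^{1,0}_xX)^*$. Given $T^{1,0}_xX=U_x\oplus V_x$, identify $(T^{1,0}_xX)^*=U_x^*\oplus V_x^*$ ($U_x^*$ being the forms vanishing on $V_x$, and $V_x^*$ those vanishing on $U_x$). Choose holomorphic coordinates with $U_x=\mathrm{span}\{\partial_1,\dots,\partial_{n_0}\}$ and $V_x=\mathrm{span}\{\partial_{n_0+1},\dots,\partial_n\}$ at $x$, $n_0=\dim U_x$. If the entries of $B$ are $B_{ip}=\sum_{\alpha=1}^{n_0}B_{ip\bar\alpha}d\bar z^\alpha\in\overline{U_x^*}$ and those of $A$ are $A_{jp}=\sum_{\alpha=n_0+1}^nA_{jp\alpha}dz^\alpha\in V_x^*$, then $\mathbf{B}$ is the $N_2\times rn_0$ complex matrix with entry $B_{ip\bar\alpha}$ in row $p$ and column $(i,\alpha)$ ($1\le\alpha\le n_0$), and $\mathbf{A}$ is the $N_1\times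 r(n-n_0)$ complex matrix with entry $A_{jp\alpha}$ in row $p$ and column $(j,\alpha)$ ($n_0+1\le\alpha\le n$). *)

(* Defs.v *)
From HB Require Import structures.
From mathcomp Require Import all_boot all_order all_algebra.
From mathcomp Require Import all_classical all_reals all_analysis.
From mathcomp Require Import complex.

Set Implicit Arguments.
Unset Strict Implicit.
Unset Printing Implicit Defensive.

Import Order.TTheory GRing.Theory Num.Theory.
Import numFieldNormedType.Exports.

Local Open Scope classical_set_scope.
Local Open Scope ring_scope.

(* The usual topology and norm on R[i], which the libraries only provide on the
   alias R[i]^o. *)
#[export] HB.instance Definition _ (R : rcfType) :=
  NormedModule.copy (complex R) (complex R)^o.

Section Calculus.
Variables (R : realType) (n : nat).
Local Notation C := (complex R).
Implicit Types (f : 'rV[C]_n -> C) (v z : 'rV[C]_n) (D : set 'rV[C]_n).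

(* C^n is here a real vector space: f is restricted to the real line
   t |-> z + t v, and its real and imaginary parts are differentiated. *)
Definition line_re f v z (t : R) : R := complex.Re (f (z + (t%:C)%C *: v)).
Definition line_im f v z (t : R) : R := complex.Im (f (z + (t%:C)%C *: v)).

Definition real_derivable f v z : Prop :=
  derivable (line_re f v z) 0 1 /\ derivable (line_im f v z) 0 1.

Definition real_deriv v f z : C :=
  ('D_1 (line_re f v z) 0 +i* 'D_1 (line_im f v z) 0)%C.

Fixpoint Ck (k : nat) D f : Prop :=
  (forall z, D z -> {for z, continuous f}) /\
  match k with
  | 0 => True
  | k'.+1 => forall v, (forall z, D z -> real_derivable f v z) /\
                       Ck k' D (real_deriv v f)
  end.

Definition smooth_on D f : Prop := forall k, Ck k D f.

Definition coordvec (a : 'I_n) : 'rV[C]_n := delta_mx 0 a.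
Definition ii : C := (0 +i* 1)%C.

(* partial_a = (partial_x - i partial_y) / 2 *)
Definition del (a : 'I_n) f z : C :=
  2^-1 * (real_deriv (coordvec a) f z - ii * real_deriv (ii *: coordvec a) f z).

(* partial_(bar a) = (partial_x + i partial_y) / 2 *)
Definition delbar (a : 'I_n) f z : C :=
  2^-1 * (real_deriv (coordvec a) f z + ii * real_deriv (ii *: coordvec a) f z).

End Calculus.

Record chart (R : realType) (n : nat) (X : topologicalType) := Chart {
  cdom : set X;
  ccoord : X -> 'rV[complex R]_n;
  cinv : 'rV[complex R]_n -> X;
  cdom_open : open cdom;
  cimg_open : open (ccoord @` cdom);
  cinvK : {in cdom, cancel ccoord cinv};
  ccoord_cont : {within cdom, continuous ccoord};
  cinv_cont : {within ccoord @` cdom, continuous cinv}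
}.

(* The change of coordinates from k to k' is holomorphic, i.e. differentiable
   over the field R[i]. *)
Definition holo_transition (R : realType) (n : nat) (X : topologicalType)
    (k k' : chart R n X) : Prop :=
  forall z, (ccoord k @` (cdom k `&` cdom k')) z ->
    differentiable (ccoord k' \o cinv k : 'rV[complex R]_n -> 'rV[complex R]_n) z.

Record complex_manifold (R : realType) (n : nat) := ComplexManifold {
  carrier :> topologicalType;
  manifold_hausdorff : hausdorff_space carrier;
  manifold_second_countable : @second_countable carrier;
  atlas : set (chart R n carrier);
  atlas_cover : forall x : carrier, exists2 k, atlas k & cdom k x;
  atlas_holo : forall k k', atlas k -> atlas k' -> holo_transition k k'
}.

(* Membership in the maximal atlas. *)
Definition holo_chart (R : realType) (n : nat) (X : complex_manifold R n)
    (k : chart R n X) : Prop :=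
  forall k', atlas k' -> holo_transition k k' /\ holo_transition k' k.

Definition holomorphic_on (R : realType) (n : nat) (X : complex_manifold R n)
    (D : set X) (f : X -> complex R) : Prop :=
  forall k : chart R n X, holo_chart k ->
  forall z, (ccoord k @` (cdom k `&` D)) z ->
    differentiable (f \o cinv k : 'rV[complex R]_n -> complex R) z.

Record local_frame (R : realType) (r : nat) (X : topologicalType)
    (E : X -> vectType (complex R)) := LocalFrame {
  fdom : set X;
  fsec : forall x, r.-tuple (E x);
  fdom_open : open fdom;
  fsec_basis : forall x, fdom x -> basis_of fullv (fsec x)
}.

(* Column i holds the coordinates of f_i in the basis e. *)
Definition change_basis (K : fieldType) (vT : vectType K) (r : nat)
    (e f : r.-tuple vT) : 'M[K]_r :=
  \matrix_(k, i) coord e k (tnth f i).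

Definition holo_frame_change (R : realType) (n r : nat)
    (X : complex_manifold R n) (E : X -> vectType (complex R))
    (e f : local_frame r E) : Prop :=
  forall k i, holomorphic_on (fdom e `&` fdom f)
    (fun x => change_basis (fsec e x) (fsec f x) k i).

(* The holomorphic structure is a family of local frames covering X, with
   holomorphic changes of frame. *)
Record holo_bundle (R : realType) (n : nat) (X : complex_manifold R n)
    (r : nat) := HoloBundle {
  fiber :> X -> vectType (complex R);
  frames : set (local_frame r fiber);
  frames_cover : forall x, exists2 e, frames e & fdom e x;
  frames_holo : forall e f, frames e -> frames f -> holo_frame_change e f
}.

Definition holo_frame (R : realType) (n : nat) (X : complex_manifold R n)
    (r : nat) (E : holo_bundle X r) (e : local_frame r E) : Prop :=
  forall f, frames f -> holo_frame_change e f /\ holo_frame_change f e.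

Record hermitian_metric (R : realType) (n : nat) (X : complex_manifold R n)
    (r : nat) (E : holo_bundle X r) := HermitianMetric {
  herm :> forall x, E x -> E x -> complex R;
  herm_linear : forall x (w : E x) a u v,
    herm (a *: u + v) w = a * herm u w + herm v w;
  herm_sym : forall x (u v : E x), herm v u = (herm u v)^*;
  herm_pos : forall x (u : E x), u != 0 -> 0 < herm u u;
  herm_smooth : forall (k : chart R n X) (e : local_frame r E),
    holo_chart k -> holo_frame e ->
    forall i j, smooth_on (ccoord k @` (cdom k `&` fdom e))
      (fun z => herm (tnth (fsec e (cinv k z)) i) (tnth (fsec e (cinv k z)) j))
}.

Section Curvature.
Variables (R : realType) (n : nat) (X : complex_manifold R n) (r : nat).
Variables (E : holo_bundle X r) (h : hermitian_metric E).
Local Notation C := (complex R).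
Variables (k : chart R n X) (e : local_frame r E).

(* H = (h_(i jbar)), with i the row and j the column. *)
Definition gram (z : 'rV[C]_n) : 'M[C]_r :=
  \matrix_(i, j) h (cinv k z) (tnth (fsec e (cinv k z)) i)
                              (tnth (fsec e (cinv k z)) j).

Definition del_gram (a : 'I_n) (z : 'rV[C]_n) : 'M[C]_r :=
  \matrix_(i, j) del a (fun w => gram w i j) z.

Definition delbar_gram (b : 'I_n) (z : 'rV[C]_n) : 'M[C]_r :=
  \matrix_(i, j) delbar b (fun w => gram w i j) z.

Definition deldelbar_gram (a b : 'I_n) (z : 'rV[C]_n) : 'M[C]_r :=
  \matrix_(i, j) del a (delbar b (fun w => gram w i j)) z.

(* Entry (i, j) of curv x a b is R_(i jbar a bbar) at x. *)
Definition curv (x : X) (a b : 'I_n) : 'M[C]_r :=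
  let z := ccoord k x in
  - deldelbar_gram a b z + del_gram a z *m invmx (gram z) *m delbar_gram b z.

(* Entry (j, i) is R^j_(i a bbar): the relation R_(i jbar) = R^l_i h_(l jbar)
   reads curv = (R^l_i)^T *m gram. *)
Definition curv_endo (x : X) (a b : 'I_n) : 'M[C]_r :=
  (curv x a b *m invmx (gram (ccoord k x)))^T.

(* The matrix of the same endomorphism in another basis f of E_x. *)
Definition curv_endo_in (x : X) (f : r.-tuple (E x)) (a b : 'I_n) : 'M[C]_r :=
  let P := change_basis (fsec e x) f in
  invmx P *m curv_endo x a b *m P.

End Curvature.

(* T^(1,0)_x X is identified with C^n by the basis partial_1, ..., partial_n of
   a chart at x, and E_x (x) T^(1,0)_x X with r x n matrices u = (u^(i a)) by
   means of a frame. *)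
Definition splitting (K : fieldType) (vT : vectType K) (U V : {vspace vT}) : Prop :=
  (U + V)%VS = fullv /\ (U :&: V)%VS = 0%VS.

Definition in_tensor (K : fieldType) (r n : nat) (U : {vspace 'rV[K]_n})
    (u : 'M[K]_(r, n)) : Prop :=
  forall i, row i u \in U.

(* The curvature is a tensor, so the conditions below do not depend on the
   chart k and the frame e; they are required for every choice. *)
Section Positivity.
Variables (R : realType) (n : nat) (X : complex_manifold R n) (r : nat).
Variables (E : holo_bundle X r) (h : hermitian_metric E).
Local Notation C := (complex R).

Definition curv_form (k : chart R n X) (e : local_frame r E) (x : X)
    (u v : 'M[C]_(r, n)) : C :=
  \sum_i \sum_j \sum_a \sum_b curv h k e x a b i j * u i a * (v j b)^*.

(* Here v j a is the coefficient v^(jbar a) on ebar_j (x) partial_a, so the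
   indices i and j are exchanged with respect to curv_form. *)
Definition curv_form_bar (k : chart R n X) (e : local_frame r E) (x : X)
    (v : 'M[C]_(r, n)) : C :=
  \sum_i \sum_j \sum_a \sum_b curv h k e x a b i j * v j a * (v i b)^*.

Definition decomposably_typeI (gt0 : C -> Prop) : Prop :=
  forall (x : X) (k : chart R n X) (e : local_frame r E),
  holo_chart k -> cdom k x -> holo_frame e -> fdom e x ->
  exists U V : {vspace 'rV[C]_n},
  [/\ splitting U V,
      forall u : 'M[C]_(r, n), in_tensor U u -> u != 0 ->
        gt0 (curv_form k e x u u),
      forall u v' : 'M[C]_(r, n), in_tensor U u -> u != 0 ->
        in_tensor V v' -> v' != 0 -> curv_form k e x u v' = 0
    & forall v : 'M[C]_(r, n), in_tensor V v -> v != 0 ->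
        gt0 (curv_form_bar k e x v)].

(* On R[i], 0 < c and 0 <= c entail that c is real. *)
Definition strongly_decomposably_positive_I : Prop :=
  decomposably_typeI (fun c => 0 < c).
Definition strongly_decomposably_nonnegative_I : Prop :=
  decomposably_typeI (fun c => 0 <= c).

End Positivity.

Section Forms.
Variables (R : realType) (n : nat).
Local Notation C := (complex R).

(* A complex one-form at a point is the row of its coefficients on
   dz^1, ..., dz^n, dzbar^1, ..., dzbar^n; a tangent vector of the complexified
   tangent space is the row of its coefficients on the dual basis. *)
Definition form1 := 'rV[C]_(n + n).

Definition dz (a : 'I_n) : form1 := delta_mx 0 (lshift n a).
Definition dzbar (b : 'I_n) : form1 := delta_mx 0 (rshift n b).

Definition conj_form (xi : form1) : form1 :=
  row_mx (map_mx Num.conj (rsubmx xi)) (map_mx Num.conj (lsubmx xi)).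

Definition is_10 (xi : form1) : Prop := rsubmx xi = 0.
Definition is_01 (xi : form1) : Prop := lsubmx xi = 0.

(* A two-form is the antisymmetric matrix of its values on the basis of the
   complexified tangent space. *)
Definition wedge (xi eta : form1) : 'M[C]_(n + n) :=
  xi^T *m eta - eta^T *m xi.

Definition eval_form (xi : form1) (w : 'rV[C]_(n + n)) : C := (xi *m w^T) 0 0.

Definition tvec (v : 'rV[C]_n) : 'rV[C]_(n + n) := row_mx v 0.
Definition tvec_bar (v : 'rV[C]_n) : 'rV[C]_(n + n) :=
  row_mx 0 (map_mx Num.conj v).

(* (1,0)-forms vanishing on V; with V the complement of U this is U^*. *)
Definition annihilates (V : {vspace 'rV[C]_n}) (xi : form1) : Prop :=
  is_10 xi /\ forall v, v \in V -> eval_form xi (tvec v) = 0.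

Section MatricesOfForms.
Variables (r N : nat).
Implicit Type M : 'M[form1]_(r, N).

Definition conj_forms M : 'M[form1]_(r, N) := map_mx conj_form M.

Definition wedge_conjT M : 'M['M[C]_(n + n)]_r :=
  \matrix_(j, i) \sum_p wedge (M j p) (conj_form (M i p)).

Definition entries_span M : {vspace 'rV[C]_(n + n)} :=
  (\sum_(i < r) \sum_(p < N) <[M i p]>)%VS.

(* When t is a basis of V and the entries of M lie in V^*, the value of M i p
   on the a-th vector of t is its coefficient on dz^a in any coordinates where
   these vectors are the partial_a spanning V. mxvec makes (i, a) the column
   index. *)
Definition coef_mx d (t : d.-tuple 'rV[C]_n) M : 'M[C]_(N, r * d) :=
  \matrix_(p < N) mxvec (\matrix_(i < r, a < d) eval_form (M i p) (tvec (tnth t a))).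

Definition coef_mx_bar d (t : d.-tuple 'rV[C]_n) M : 'M[C]_(N, r * d) :=
  \matrix_(p < N) mxvec (\matrix_(i < r, a < d) eval_form (M i p) (tvec_bar (tnth t a))).

End MatricesOfForms.

End Forms.

Section CurvatureMatrix.
Variables (R : realType) (n : nat) (X : complex_manifold R n) (r : nat).
Variables (E : holo_bundle X r) (h : hermitian_metric E).

Definition unitary_frame (x : X) (f : r.-tuple (E x)) : Prop :=
  basis_of fullv f /\ forall i j, h x (tnth f i) (tnth f j) = (i == j)%:R.

(* The curvature matrix at x in the basis f of E_x, with entry (j, i) the
   two-form R^j_i. *)
Definition curvature_matrix (k : chart R n X) (e : local_frame r E) (x : X)
    (f : r.-tuple (E x)) : 'M['M[complex R]_(n + n)]_r :=
  \matrix_(j, i) \sum_a \sum_b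
    curv_endo_in h k e f a b j i *: wedge (dz R a) (dzbar R b).

Definition curvature_factorization (k : chart R n X) (e : local_frame r E)
    (x : X) (f : r.-tuple (E x)) (N1 N2 : nat)
    (B : 'M[form1 R n]_(r, N2)) (A : 'M[form1 R n]_(r, N1)) : Prop :=
  [/\ unitary_frame f,
      (forall i p, is_01 (B i p)) /\ (forall i p, is_10 (A i p)),
      curvature_matrix k e f = - wedge_conjT B + wedge_conjT A
    & (entries_span (conj_forms B) :&: entries_span A)%VS = 0%VS].

End CurvatureMatrix.

(* Main.v *)
Require Import Defs.
From HB Require Import structures.
From mathcomp Require Import all_boot all_order all_algebra.
From mathcomp Require Import all_classical all_reals all_analysis.
From mathcomp Require Import complex.
From mathcomp Require Import ring.
Set Implicit Arguments.
Unset Strict Implicit.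
Unset Printing Implicit Defensive.
Import Order.TTheory GRing.Theory Num.Theory.
Import numFieldNormedType.Exports.
Local Open Scope classical_set_scope.
Local Open Scope ring_scope.

(** Write R_(i jbar s tbar) for the curvature in a unitary frame of E_x. The
    equation R = - B /\ Bbar^T + A /\ Abar^T says that
      R_(i jbar s tbar) = sum_p b_(p i s) conj b_(p j t)
                          + sum_p c_(p j s) conj c_(p i t),
    where b and c are the coefficients of Bbar and A. If Bbar vanishes on V and
    A vanishes on U, the first sum is the curvature form on E (x) U, the second
    one is the conjugated form on Ebar (x) V, and the mixed terms drop out; both
    are sums of squares, definite exactly when the coefficient matrices have full
    column rank. Such a splitting U (+) V exists as soon as the spans of Bbar and
    A meet trivially: extend them to complementary subspaces of the cotangent
    space and take annihilators.

    Conversely, the form on E (x) U, extended by zero along V, is positive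
    semidefinite, hence by the spectral theorem a sum of squares of linear forms
    which kill V, and similarly for Ebar (x) V. To recover the whole curvature
    from these two restrictions one needs its value on (V, U) as well as on
    (U, V), hence the Hermitian symmetry conj R_(i jbar s tbar) = R_(j ibar t sbar),
    which rests on the symmetry of the second derivatives of the metric. *)

(** * Linear algebra of curvature-like tensors *)

Section Splittings.
Variables (K : fieldType) (n : nat).
Implicit Types (U V W : {vspace 'rV[K]_n}).

Lemma daddv_pi0 U V (x : 'rV[K]_n) : (U :&: V = 0)%VS -> x \in V -> daddv_pi U V x = 0.
Proof.
move=> UV0 Vx; have VU0 : (V :&: U = 0)%VS by rewrite capvC.
have /(daddv_pi_add UV0) : x \in (U + V)%VS by apply: subvP Vx; exact: addvSr.
by rewrite (daddv_pi_id VU0 Vx) => /(canRL (addrK _)); rewrite subrr.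
Qed.

Lemma splitting_annihilators W1 W2 : (W1 :&: W2 = 0)%VS ->
  exists U V, [/\ splitting U V,
    forall w v, w \in W1 -> v \in V -> w *m v^T = 0 &
    forall w u, w \in W2 -> u \in U -> w *m u^T = 0].
Proof.
(* W1' and W2 are complementary; U and V are the images of the transposes of the
   two projections. *)
move=> W0; pose W1' := (W1 + (W1 + W2)^C)%VS.
have W1'0 : (W1' :&: W2 = 0)%VS.
  apply/eqP; rewrite -subv0; apply/subvP=> x; rewrite memv_cap.
  case/andP=> /memv_addP[w1 Ww1 [c Wc defx]] W2x; rewrite -W0 memv_cap W2x andbT.
  (* The component [c] equals [x - w1], so it lies in [W1 + W2] as well as in the complement. *)
  suff /eqP c0 : c == 0 by rewrite defx c0 addr0.
  rewrite -memv0 -(capv_compl (W1 + W2)) memv_cap Wc andbT.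
  rewrite (canRL (addKr _) (esym defx)) addrC.
  apply: rpredB; first exact: subvP (addvSr _ _) _ W2x.
  exact: subvP (addvSl _ _) _ Ww1.
pose P := lin1_mx (daddv_pi W1' W2).
have PE x : x *m P = daddv_pi W1' W2 x by exact: mul_rV_lin1.
have PP : P *m P = P.
  by apply/row_matrixP=> i; rewrite row_mul PE [row i P]rowE PE daddv_pi_proj.
have memP (Q : 'M[K]_n) v : (v \in limg (linfun (mulmxr Q^T : 'rV_n -> 'rV_n))) ->
    exists w, v = w *m Q^T.
  by case/memv_imgP=> w _ ->; exists w; rewrite lfunE.
exists (limg (linfun (mulmxr P^T : 'rV_n -> 'rV_n))).
exists (limg (linfun (mulmxr (1%:M - P)^T : 'rV_n -> 'rV_n))).
have P1 : P *m (1%:M - P) = 0 by rewrite mulmxBr PP mulmx1 subrr.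
have P2 : (1%:M - P) *m P = 0 by rewrite mulmxBl PP mul1mx subrr.
split; first split.
- apply/vspaceP=> v; rewrite memvf; apply/memv_addP.
  exists (v *m P^T).
    by apply/memv_imgP; exists v; rewrite ?memvf ?lfunE.
  exists (v *m (1%:M - P)^T); last by rewrite -mulmxDr -linearD addrC subrK /= trmx1 mulmx1.
  by apply/memv_imgP; exists v; rewrite ?memvf ?lfunE.
- apply/eqP; rewrite -subv0; apply/subvP=> x; rewrite memv_cap memv0.
  case/andP=> /memP[w ->] /memP[w' defx].
  rewrite -[w *m P^T](mulmx1) -trmx1 -(subrK P 1%:M) linearD mulmxDr /=.
  rewrite -mulmxA -trmx_mul P2 trmx0 mulmx0 add0r defx -mulmxA -trmx_mul P1.
  by rewrite trmx0 mulmx0.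
- move=> w v W1w /memP[x ->]; have W1'w : w \in W1' by apply: subvP W1w; exact: addvSl.
  rewrite -(daddv_pi_id W1'0 W1'w) -PE trmx_mul trmxK mulmxA -[w *m P *m _]mulmxA.
  by rewrite P1 mulmx0 mul0mx.
- move=> w u W2w /memP[x ->]; rewrite trmx_mul trmxK mulmxA PE.
  by rewrite daddv_pi0 // mul0mx.
Qed.

(** A covector in both subspaces vanishes on [U] and on [V], hence on the standard basis, where its
    values are its coordinates. *)
Lemma splitting_annihilators_disjoint U V W1 W2 : splitting U V ->
  (forall w v, w \in W1 -> v \in V -> w *m v^T = 0) ->
  (forall w u, w \in W2 -> u \in U -> w *m u^T = 0) -> (W1 :&: W2 = 0)%VS.
Proof.
move=> [UV _] W1V W2U; apply/eqP; rewrite -subv0; apply/subvP=> w.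
rewrite memv_cap memv0 => /andP[W1w W2w]; apply/eqP/rowP=> a.
have /memv_addP[u Uu [v Vv defa]] : delta_mx 0 a \in (U + V)%VS by rewrite UV memvf.
have : w *m (delta_mx 0 a : 'rV_n)^T = 0.
  by rewrite defa linearD mulmxDr (W2U w u) ?(W1V w v) ?addr0.
by rewrite trmx_delta -colE => /colP/(_ 0); rewrite !mxE.
Qed.
End Splittings.

(** * Semidefinite Hermitian matrices as sums of squares *)

Section LinearAlgebra.
Variable C : numClosedFieldType.
Local Open Scope sesquilinear_scope.

Lemma psd_factor m (M : 'M[C]_m) :
  M ^t* = M -> (forall u : 'rV_m, 0 <= (u *m M *m u ^t*) 0 0) ->
  exists Q : 'M[C]_m, M = Q^T *m map_mx Num.conj Q.
Proof.
move=> Mherm Mpos.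
have /hermitian_normalmx/orthomx_spectralP : M \is hermsymmx.
  by apply/is_hermitianmxP; rewrite expr0 scale1r Mherm.
have Uu := spectral_unitarymx M; rewrite invmx_unitary //.
set U := spectralmx M in Uu *; set D := spectral_diag M => defM.
(* Each eigenvalue is the value of the form on a row of [U]. *)
have D_ge0 p : 0 <= D 0 p.
  have -> : D 0 p = (U *m M *m U ^t*) p p.
    rewrite defM !mulmxA (unitarymxP Uu) mul1mx -mulmxA (unitarymxP Uu).
    by rewrite mulmx1 mxE eqxx mulr1n.
  suff -> : (U *m M *m U ^t*) p p = (row p U *m M *m (row p U) ^t*) 0 0 by [].
  rewrite !mxE; apply: eq_bigr => i _; rewrite !mxE; congr (_ * _).
  by apply: eq_bigr => k _; rewrite !mxE.
(* The entries of [U] are conjugated because the left factor is to be [Q^T], while the spectral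
   theorem puts the adjoint of [U] there. *)
exists (\matrix_(p, i) (sqrtC (D 0 p) * (U p i)^*)).
rewrite {1}defM mul_mx_diag; apply/matrixP=> i j; rewrite !mxE.
apply: eq_bigr => p _; rewrite !mxE rmorphM /= conjCK.
rewrite [(sqrtC _)^*]geC0_conj ?sqrtC_ge0 // mulrACA -expr2 sqrtCK.
by rewrite mulrAC mulrC.
Qed.

(** An arbitrary finite index type lets a pair of a bundle index and a tangent index serve as one
    matrix index. *)
Lemma psd_factor_fin (T : finType) (M : T -> T -> C) :
  (forall s t, (M t s)^* = M s t) ->
  (forall u : T -> C, 0 <= \sum_s \sum_t M s t * u s * (u t)^*) ->
  exists q : 'I_#|T| -> T -> C, forall s t, M s t = \sum_p q p s * (q p t)^*.
Proof.
move=> Mherm Mpos.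
pose M' : 'M[C]_#|T| := \matrix_(i, j) M (enum_val i) (enum_val j).
have [||Q defM] := @psd_factor _ M'.
- by apply/matrixP=> i j; rewrite !mxE Mherm.
- move=> u; have := Mpos (fun s => u 0 (enum_rank s)).
  rewrite (reindex _ (onW_bij _ (enum_val_bij T))) exchange_big /=.
  rewrite (reindex _ (onW_bij _ (enum_val_bij T))) /=.
  congr (0 <= _); rewrite !mxE; apply: eq_bigr => j _.
  rewrite !mxE mulr_suml; apply: eq_bigr => i _.
  by rewrite !mxE !enum_valK [M _ _ * _]mulrC.
exists (fun p s => Q p (enum_rank s)) => s t.
have /matrixP/(_ (enum_rank s) (enum_rank t)) := defM.
by rewrite !mxE !enum_rankK => ->; apply: eq_bigr => p _; rewrite !mxE.
Qed.

End LinearAlgebra.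

(** * Curvature-like tensors and their factorizations *)

Section TensorForms.
Variables (C : numClosedFieldType) (r n : nat).
Local Open Scope sesquilinear_scope.
Implicit Types (S : 'I_n -> 'I_n -> 'M[C]_r) (u v w : 'M[C]_(r, n)).
Implicit Types (x y : 'rV[C]_n) (Z : 'M[C]_n) (U V : {vspace 'rV[C]_n}).

Definition tensor_form S u v : C :=
  \sum_i \sum_j \sum_a \sum_b S a b i j * u i a * (v j b)^*.

(** For fixed bundle indices, the matrix of a sesquilinear form on the tangent space. *)
Definition slice S i j : 'M[C]_n := \matrix_(a, b) S a b i j.

(* Exchanging i and j turns curv_form into curv_form_bar. *)
Definition tensor_tr S a b : 'M[C]_r := (S a b)^T.

Definition tensor_herm S : Prop := forall a b i j, (S a b i j)^* = S b a j i.

(* Row i of b p is the linear form x |-> sum_a (b p i a) x_a. *)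
Definition kills (N : nat) (b : 'I_N -> 'M[C]_(r, n)) V : Prop :=
  forall p x, x \in V -> b p *m x^T = 0.

(* b comes from Bbar and c from A; i and j are exchanged in the second sum. *)
Definition tensor_factor S N1 N2 (c : 'I_N1 -> 'M[C]_(r, n))
    (b : 'I_N2 -> 'M[C]_(r, n)) : Prop :=
  forall a a' i j, S a a' i j =
    \sum_p b p i a * (b p j a')^* + \sum_p c p j a * (c p i a')^*.

Lemma sesquiE Z x y :
  (x *m Z *m y ^t*) 0 0 = \sum_a \sum_b Z a b * x 0 a * (y 0 b)^*.
Proof.
rewrite mxE exchange_big; apply: eq_bigr => b _; rewrite !mxE mulr_suml.
by apply: eq_bigr => a _; rewrite [x _ _ * _]mulrC.
Qed.

Lemma tensor_formE S u v : tensor_form S u v =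
  \sum_i \sum_j (row i u *m slice S i j *m (row j v) ^t*) 0 0.
Proof.
apply: eq_bigr => i _; apply: eq_bigr => j _; rewrite sesquiE.
by apply: eq_bigr => a _; apply: eq_bigr => b _; rewrite !mxE.
Qed.

Lemma mul_row_tr m (b : 'M[C]_(m, n)) (x : 'rV[C]_n) j :
  x *m (row j b)^T = ((b *m x^T) j 0)%:M.
Proof.
apply/matrixP=> k l; rewrite !ord1 !mxE eqxx mulr1n.
by apply: eq_bigr => a _; rewrite !mxE mulrC.
Qed.

(** Each summand of a factorization is a column times a conjugated row, so it contributes a linear
    form at [x] times a conjugated linear form at [y]. *)
Lemma tensor_factor_slice S N1 N2 (c : 'I_N1 -> 'M[C]_(r, n))
    (b : 'I_N2 -> 'M[C]_(r, n)) i j x y : tensor_factor S c b ->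
  (x *m slice S i j *m y ^t*) 0 0 =
    \sum_p (b p *m x^T) i 0 * ((b p *m y^T) j 0)^* +
    \sum_p (c p *m x^T) j 0 * ((c p *m y^T) i 0)^*.
Proof.
move=> Sf.
have -> : slice S i j =
    \sum_p (row i (b p))^T *m map_mx Num.conj (row j (b p)) +
    \sum_p (row j (c p))^T *m map_mx Num.conj (row i (c p)).
  apply/matrixP=> a a'; rewrite !mxE Sf !summxE; congr (_ + _);
    by apply: eq_bigr => p _; rewrite !mxE big_ord1 !mxE.
have mulE N (d d' : 'I_N -> 'rV[C]_n) :
    x *m (\sum_p (d p)^T *m map_mx Num.conj (d' p)) *m y ^t* =
    \sum_p (x *m (d p)^T) *m (y *m (d' p)^T) ^t*.
  rewrite mulmx_sumr mulmx_suml; apply: eq_bigr => p _.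
  by rewrite trmx_mul trmxK map_mxM !mulmxA.
rewrite mulmxDr mulmxDl !mulE mxE !summxE.
congr (_ + _); apply: eq_bigr => p _; rewrite !mul_row_tr.
  by rewrite mul_scalar_mx !mxE eqxx mulr1n.
by rewrite mul_scalar_mx !mxE eqxx mulr1n.
Qed.

Lemma mulmx_row_tr m (b : 'M[C]_(m, n)) k (u : 'M[C]_(k, n)) i j :
  (b *m (row i u)^T) j 0 = (b *m u^T) j i.
Proof. by rewrite !mxE; apply: eq_bigr => a _; rewrite !mxE. Qed.

Lemma kills_tensor N (b : 'I_N -> 'M[C]_(r, n)) V v :
  kills b V -> in_tensor V v -> forall p, b p *m v^T = 0.
Proof.
move=> bV Vv p; apply/matrixP=> j i.
by rewrite -mulmx_row_tr (bV _ _ (Vv i)) !mxE.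
Qed.

(** The [c] terms vanish on [u]; in each remaining term the sums over [i] and [j] separate into two
    traces. *)
Lemma tensor_form_factor S N1 N2 (c : 'I_N1 -> 'M[C]_(r, n))
    (b : 'I_N2 -> 'M[C]_(r, n)) u v :
  tensor_factor S c b -> (forall p, c p *m u^T = 0) ->
  tensor_form S u v = \sum_p \tr (b p *m u^T) * (\tr (b p *m v^T))^*.
Proof.
move=> Sf cu; rewrite tensor_formE.
under eq_bigr => i _ do under eq_bigr => j _ do
  (rewrite (tensor_factor_slice _ _ _ _ Sf);
   under [X in _ + X]eq_bigr => p _ do rewrite mulmx_row_tr cu mxE mul0r;
   rewrite big1_eq addr0).
under eq_bigr => i _ do rewrite exchange_big /=.
rewrite exchange_big /=; apply: eq_bigr => p _.
rewrite rmorph_sum mulr_suml; apply: eq_bigr => i _; rewrite mulr_sumr.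
by apply: eq_bigr => j _; rewrite !mulmx_row_tr.
Qed.

(** On such [u] the form is a sum of squared moduli. The equality case is recorded because it
    decides definiteness. *)
Lemma tensor_form_factor_ge0 S N1 N2 (c : 'I_N1 -> 'M[C]_(r, n))
    (b : 'I_N2 -> 'M[C]_(r, n)) u :
  tensor_factor S c b -> (forall p, c p *m u^T = 0) ->
  0 <= tensor_form S u u ?= iff [forall p, \tr (b p *m u^T) == 0].
Proof.
move=> Sf cu; rewrite (tensor_form_factor _ Sf cu).
have ge0 p : 0 <= \tr (b p *m u^T) * (\tr (b p *m u^T))^* by exact: mul_conjC_ge0.
split; first by apply: sumr_ge0 => p _; exact: ge0.
rewrite eq_sym psumr_eq0 //; apply/allP/forallP => h p.
  by have := h p (mem_index_enum _); rewrite mul_conjC_eq0.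
by rewrite mul_conjC_eq0 h.
Qed.

(** Transposition exchanges the roles of [b] and [c], so results about [U] carry over to the
    conjugated form on [V]. *)
Lemma tensor_factor_tr S N1 N2 (c : 'I_N1 -> 'M[C]_(r, n))
    (b : 'I_N2 -> 'M[C]_(r, n)) :
  tensor_factor S c b -> tensor_factor (tensor_tr S) b c.
Proof. by move=> Sf a a' i j; rewrite mxE Sf addrC. Qed.

Lemma tensor_herm_tr S : tensor_herm S -> tensor_herm (tensor_tr S).
Proof. by move=> Sh a b i j; rewrite !mxE. Qed.

Lemma tensor_form_trE S v : tensor_form (tensor_tr S) v v =
  \sum_i \sum_j \sum_a \sum_b S a b i j * v j a * (v i b)^*.
Proof.
rewrite /tensor_form exchange_big; apply: eq_bigr => i _; apply: eq_bigr => j _.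
by apply: eq_bigr => a _; apply: eq_bigr => b _; rewrite mxE.
Qed.

(** Decomposable tensors isolate one slice, which turns conditions on tensors into conditions on
    slices. *)
Lemma tensor_form_simple S i j x y :
  tensor_form S (delta_mx i 0 *m x) (delta_mx j 0 *m y) =
  (x *m slice S i j *m y ^t*) 0 0.
Proof.
have rowE k l (z : 'rV[C]_n) :
    row k (delta_mx l (0 : 'I_1) *m z : 'M[C]_(r, n)) = (k == l)%:R *: z.
  by apply/rowP=> a; rewrite !mxE big_ord1 !mxE eqxx andbT.
rewrite tensor_formE (bigD1 i) //= [X in _ + X]big1 ?addr0; last first.
  move=> k /negPf ki; apply: big1 => l _.
  by rewrite rowE ki scale0r !mul0mx mxE.
rewrite (bigD1 j) //= big1 ?addr0.
  by rewrite !rowE !eqxx !scale1r.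
by move=> l /negPf lj; rewrite (rowE l) lj scale0r trmx0 map_mx0 mulmx0 mxE.
Qed.

Lemma in_tensor_simple U i x : x \in U -> in_tensor U (delta_mx i 0 *m x : 'M[C]_(r, n)).
Proof.
move=> Ux k; have -> : row k (delta_mx i (0 : 'I_1) *m x : 'M[C]_(r, n)) = (k == i)%:R *: x.
  by apply/rowP=> a; rewrite !mxE big_ord1 !mxE eqxx andbT.
exact: memvZ.
Qed.

(** Pull-back of [S] along [P] in the tangent indices. For the projection onto [U] along [V] it is
    the restriction to [U], extended by zero along [V]. *)
Definition tensor_proj S (P : 'M[C]_n) a b : 'M[C]_r :=
  \matrix_(i, j) (P *m slice S i j *m P ^t*) a b.

Lemma slice_proj S P i j : slice (tensor_proj S P) i j = P *m slice S i j *m P ^t*.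
Proof. by apply/matrixP=> a b; rewrite !mxE. Qed.

Lemma tensor_form_proj S P u v :
  tensor_form (tensor_proj S P) u v = tensor_form S (u *m P) (v *m P).
Proof.
rewrite !tensor_formE; apply: eq_bigr => i _; apply: eq_bigr => j _.
by rewrite slice_proj !row_mul trmx_mul map_mxM !mulmxA.
Qed.

Lemma sesqui_conj S i j x y : tensor_herm S ->
  ((x *m slice S i j *m y ^t*) 0 0)^* = (y *m slice S j i *m x ^t*) 0 0.
Proof.
move=> Sh; rewrite !sesquiE rmorph_sum exchange_big /=; apply: eq_bigr => a _.
rewrite rmorph_sum; apply: eq_bigr => b _.
by rewrite !rmorphM /= conjCK !mxE Sh mulrAC.
Qed.

Lemma tensor_herm_proj S P : tensor_herm S -> tensor_herm (tensor_proj S P).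
Proof.
move=> Sh a b i j.
have E (Z : 'M[C]_n) k l :
    (P *m Z *m P ^t*) k l = (row k P *m Z *m (row l P) ^t*) 0 0.
  rewrite !mxE; apply: eq_bigr => m _; rewrite !mxE; congr (_ * _).
  by apply: eq_bigr => o _; rewrite !mxE.
by rewrite /tensor_proj mxE [RHS]mxE !E sesqui_conj.
Qed.

Lemma tensor_form_pair S (u : 'I_r * 'I_n -> C) :
  \sum_s \sum_t S s.2 t.2 s.1 t.1 * u s * (u t)^* =
  tensor_form S (\matrix_(i, a) u (i, a)) (\matrix_(i, a) u (i, a)).
Proof.
rewrite (eq_bigr (fun s : 'I_r * 'I_n => \sum_j \sum_b
    S s.2 b s.1 j * u s * (u (j, b))^*)); last first.
  by move=> s _; rewrite pair_bigA; apply: eq_bigr => -[].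
rewrite (eq_bigr (fun s : 'I_r * 'I_n => (fun i a => \sum_j \sum_b
    S a b i j * u (i, a) * (u (j, b))^*) s.1 s.2)); last by case.
rewrite -(pair_bigA _ (fun i a => \sum_j \sum_b
    S a b i j * u (i, a) * (u (j, b))^*)) /=.
apply: eq_bigr => i _; rewrite exchange_big; apply: eq_bigr => j _.
by apply: eq_bigr => a _; apply: eq_bigr => b _; rewrite !mxE.
Qed.

(** The projected tensor is semidefinite everywhere, since its form at [u] is that of [S] at a
    tensor over [U]. It is thus a sum of squares, and it agrees with [S] on [U]. *)
Lemma tensor_form_half S U V : tensor_herm S -> splitting U V ->
  (forall u, in_tensor U u -> 0 <= tensor_form S u u) ->
  exists N (b : 'I_N -> 'M[C]_(r, n)), kills b V /\
    forall i j x y, x \in U -> y \in U ->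
      (x *m slice S i j *m y ^t*) 0 0 =
      \sum_p (b p *m x^T) i 0 * ((b p *m y^T) j 0)^*.
Proof.
move=> Sh [_ UV0] Spos; pose P := lin1_mx (daddv_pi U V).
have PE x : x *m P = daddv_pi U V x by exact: mul_rV_lin1.
pose S' := tensor_proj S P.
have S'h := tensor_herm_proj P Sh.
have [||q qE] := @psd_factor_fin C _ (fun s t : 'I_r * 'I_n => S' s.2 t.2 s.1 t.1).
- by move=> s t; rewrite S'h.
- move=> u; rewrite tensor_form_pair tensor_form_proj; apply: Spos => i.
  by rewrite row_mul PE memv_pi.
pose b p : 'M[C]_(r, n) := \matrix_(i, a) q p (i, a).
have S'f : tensor_factor S' (fun _ : 'I_0 => 0) b.
  move=> a a' i j; rewrite big_ord0 addr0 (qE (i, a) (j, a')).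
  by apply: eq_bigr => p _; rewrite !mxE.
exists _, b; split=> [p x Vx|i j x y Ux Uy].
  (* On the decomposable tensor built from [x] in [V] the projected form is zero, so every square in
     the sum vanishes. *)
  apply/colP=> i; rewrite [RHS]mxE.
  have := tensor_form_factor (delta_mx i 0 *m x) S'f (u := delta_mx i 0 *m x).
  rewrite tensor_form_proj -mulmxA PE daddv_pi0 // mulmx0 => /(_ (fun=> mul0mx _ _)).
  rewrite (_ : tensor_form S 0 0 = 0); last first.
    by rewrite tensor_formE !big1 // => k _; apply: big1 => l _; rewrite row0 !mul0mx mxE.
  move/esym/eqP; rewrite psumr_eq0 => [/allP/(_ p)|]; last first.
    by move=> k _; exact: mul_conjC_ge0.
  rewrite mem_index_enum => /(_ isT); rewrite mul_conjC_eq0 trmx_mul mulmxA.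
  rewrite trmx_delta mxtrace_mulC mulmxA -rowE trace_mx11 => /eqP <-.
  by rewrite !mxE; apply: eq_bigr => a _; rewrite !mxE.
have := tensor_factor_slice i j x y S'f.
rewrite big_ord0 addr0 slice_proj => <-.
have fixU z : z \in U -> z *m P = z by move=> Uz; rewrite PE daddv_pi_id.
by rewrite !mulmxA fixU // -!mulmxA -map_mxM -trmx_mul fixU // !mulmxA.
Qed.

(** [tensor_form_half] gives [b] from [S] on [U] and [c] from the transpose on [V]; the four blocks
    of [S] along the splitting are then compared. *)
Theorem tensor_factor_exists S U V : tensor_herm S -> splitting U V ->
  (forall u, in_tensor U u -> 0 <= tensor_form S u u) ->
  (forall u v, in_tensor U u -> in_tensor V v -> tensor_form S u v = 0) ->
  (forall v, in_tensor V v -> 0 <= tensor_form (tensor_tr S) v v) ->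
  exists N1 N2 (c : 'I_N1 -> 'M[C]_(r, n)) (b : 'I_N2 -> 'M[C]_(r, n)),
    [/\ kills b V, kills c U & tensor_factor S c b].
Proof.
move=> Sh [UV UV0] Upos cross Vpos.
have [N2 [b [bV bE]]] := tensor_form_half Sh (conj UV UV0) Upos.
have VU : splitting V U by split; rewrite ?[(V + U)%VS]addvC 1?capvC.
have [N1 [c [cU cE]]] := tensor_form_half (tensor_herm_tr Sh) VU Vpos.
exists N1, N2, c, b; split=> // a a' i j.
have cross0 k l x y : x \in U -> y \in V -> (x *m slice S k l *m y ^t*) 0 0 = 0.
  by move=> Ux Vy; rewrite -tensor_form_simple cross //; exact: in_tensor_simple.
(* Each [b p] sees only the [U] component of a vector, each [c p] only the [V] component. *)
have dec x : exists x1 x2, [/\ x1 \in U, x2 \in V, x = x1 + x2,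
    (forall p, b p *m x1^T = b p *m x^T) & forall p, c p *m x2^T = c p *m x^T].
  exists (daddv_pi U V x), (daddv_pi V U x).
  have defx : x = daddv_pi U V x + daddv_pi V U x.
    by rewrite daddv_pi_add // UV memvf.
  have Ux1 := memv_pi U V x; have Vx2 := memv_pi V U x.
  split=> // p; rewrite [in RHS]defx linearD mulmxDr.
    by rewrite [X in _ + X]bV ?addr0.
  by rewrite [X in X + _]cU ?add0r.
have [x1 [x2 [Ux1 Vx2 defx bx cx]]] := dec (delta_mx 0 a).
have [y1 [y2 [Uy1 Vy2 defy by_ cy]]] := dec (delta_mx 0 a').
have -> : S a a' i j =
    ((delta_mx 0 a : 'rV_n) *m slice S i j *m (delta_mx 0 a' : 'rV_n) ^t*) 0 0.
  by rewrite trmx_delta map_delta_mx -rowE -colE !mxE.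
have bE' p k l : b p k l = (b p *m (delta_mx 0 l : 'rV_n)^T) k 0.
  by rewrite trmx_delta -colE mxE.
have cE' p k l : c p k l = (c p *m (delta_mx 0 l : 'rV_n)^T) k 0.
  by rewrite trmx_delta -colE mxE.
have addE (A B : 'M[C]_1) : (A + B) 0 0 = A 0 0 + B 0 0 by rewrite mxE.
rewrite [in LHS]defx [in LHS]defy linearD map_mxD /= mulmxDr !mulmxDl !addE.
(* The value on [(V, U)] is the conjugate of one on [(U, V)], which is zero. *)
rewrite (cross0 i j x1 y2) // -[(x2 *m _ *m y1 ^t*) 0 0]conjCK.
rewrite (sesqui_conj i j x2 y1 Sh) cross0 // conjC0 addr0 add0r bE //.
rewrite (_ : slice S i j = slice (tensor_tr S) j i) ?cE //; last first.
  by apply/matrixP=> k l; rewrite !mxE.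
congr (_ + _); apply: eq_bigr => p _.
  by rewrite !bE' bx by_.
by rewrite !cE' cx cy.
Qed.
End TensorForms.

(** * Full column rank of evaluation matrices *)

Section Rank.
Variables (K : fieldType) (r n N : nat).

(** The transposed matrix represents the map from tensors over [U], in coordinates with respect to
    [t], to their values under the forms [b p]. Full column rank is the injectivity of this map. *)
Lemma rank_evaluationP (b : 'I_N -> 'M[K]_(r, n)) d (t : d.-tuple 'rV[K]_n)
    (U : {vspace 'rV[K]_n}) : basis_of U t ->
  \rank (\matrix_(p < N) mxvec
    (\matrix_(i < r, a < d) (row i (b p) *m (tnth t a)^T) 0 0)) = (r * d)%N <->
  (forall u, in_tensor U u -> (forall p, \tr (b p *m u^T) = 0) -> u = 0).
Proof.
move=> bas; set G := (\matrix_(p < N) _).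
pose T := \matrix_(a < d) tnth t a.
have Tfree (w : 'M[K]_(r, d)) : w *m T = 0 -> w = 0.
  move=> wT0; apply/matrixP=> i a; rewrite mxE.
  have /freeP := basis_free bas; apply=> //.
  move/row_matrixP/(_ i): wT0; rewrite row_mul mulmx_sum_row row0.
  apply: etrans.
  by apply: eq_bigr => k _; rewrite mxE rowK -tnth_nth.
have Tspan (u : 'M[K]_(r, n)) : in_tensor U u -> exists w, u = w *m T.
  move=> Uu; exists (\matrix_(i, a) coord t a (row i u)).
  apply/row_matrixP=> i; rewrite row_mul mulmx_sum_row.
  rewrite {1}(coord_basis bas (Uu i)).
  by apply: eq_bigr => k _; rewrite !mxE rowK -tnth_nth.
have TU (w : 'M[K]_(r, d)) : in_tensor U (w *m T).
  move=> i; rewrite row_mul mulmx_sum_row; apply: memv_suml => a _.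
  by apply: memvZ; rewrite rowK; apply: (basis_mem bas); exact: mem_tnth.
have GE (w : 'M[K]_(r, d)) : mxvec w *m G^T = \row_p \tr (b p *m (w *m T)^T).
  apply/rowP=> p; rewrite !mxE.
  rewrite (reindex _ (curry_mxvec_bij _ _)) /=.
  rewrite (eq_bigr (fun s : 'I_r * 'I_d => (fun i a =>
    w i a * (row i (b p) *m (tnth t a)^T) 0 0) s.1 s.2)); last first.
    by case=> i a _; rewrite mxvecE !mxE mxvecE !mxE.
  rewrite -(pair_bigA _ (fun i a => w i a * (row i (b p) *m (tnth t a)^T) 0 0)) /=.
  apply: eq_bigr => i _; rewrite trmx_mul mulmxA mxE; apply: eq_bigr => a _.
  rewrite mulrC !mxE; congr (_ * _); apply: eq_bigr => k _.
  by rewrite !mxE.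
have rankE : (\rank G == (r * d)%N) = row_free G^T by rewrite /row_free mxrank_tr.
split=> [/eqP|inj].
  rewrite rankE => /row_freeP[H GH] u /Tspan[w ->] tr0.
  suff -> : w = 0 by rewrite mul0mx.
  apply: (can_inj mxvecK); rewrite linear0 -[mxvec w]mulmx1 -GH mulmxA GE.
  rewrite (_ : \row_p _ = 0) ?mul0mx //.
  by apply/rowP=> p; rewrite mxE tr0 mxE.
apply/eqP; rewrite rankE -kermx_eq0; apply/eqP/row_matrixP=> k; rewrite row0.
have := sub_kermxP (row_sub k (kermx G^T)); rewrite -[row k _]vec_mxK GE => tr0.
rewrite (Tfree (vec_mx (row k (kermx G^T)))) ?linear0 //; apply: inj => // p.
by move/rowP/(_ p): tr0; rewrite !mxE.
Qed.
End Rank.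

(** * The type I condition at a point and its change of frame *)

Section TypeI.
Variables (C : numClosedFieldType) (r n : nat).
Implicit Types (S : 'I_n -> 'I_n -> 'M[C]_r) (P : 'M[C]_r).
Implicit Types (u v : 'M[C]_(r, n)) (U V : {vspace 'rV[C]_n}).

(** The splitting is a parameter, and the conjugated form is written through [tensor_tr] so that one
    argument serves both subspaces. *)
Definition typeI S (pos : C -> Prop) U V : Prop :=
  [/\ splitting U V,
      forall u, in_tensor U u -> u != 0 -> pos (tensor_form S u u),
      forall u v, in_tensor U u -> u != 0 -> in_tensor V v -> v != 0 ->
        tensor_form S u v = 0
    & forall v, in_tensor V v -> v != 0 -> pos (tensor_form (tensor_tr S) v v)].

(* \tr (b p *m u^T) is the value sum_(i, a) (b p i a) (u i a) on u of the linear
   form b p on C^r (x) C^n. *)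
Definition nondegenerate N (b : 'I_N -> 'M[C]_(r, n)) U : Prop :=
  forall u, in_tensor U u -> (forall p, \tr (b p *m u^T) = 0) -> u = 0.

Lemma tensor_form0l S v : tensor_form S 0 v = 0.
Proof.
by rewrite tensor_formE !big1 // => i _; apply: big1 => j _; rewrite row0 !mul0mx mxE.
Qed.

Lemma tensor_form0r S u : tensor_form S u 0 = 0.
Proof.
rewrite tensor_formE !big1 // => i _; apply: big1 => j _.
by rewrite row0 trmx0 map_mx0 mulmx0 mxE.
Qed.

Lemma typeI_factor S U V : tensor_herm S -> typeI S (fun c => 0 <= c) U V ->
  exists N1 N2 (c : 'I_N1 -> 'M[C]_(r, n)) (b : 'I_N2 -> 'M[C]_(r, n)),
    [/\ kills b V, kills c U & tensor_factor S c b].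
Proof.
move=> Sh [UV Upos cross Vpos]; apply: tensor_factor_exists UV _ _ _ => //.
- move=> u Uu; have [->|] := eqVneq u 0; [by rewrite tensor_form0l|exact: Upos].
- move=> u v Uu Vv; have [->|u0] := eqVneq u 0; first by rewrite tensor_form0l.
  by have [->|v0] := eqVneq v 0; [rewrite tensor_form0r|exact: cross].
- move=> v Vv; have [->|] := eqVneq v 0; [by rewrite tensor_form0l|exact: Vpos].
Qed.

Lemma factor_typeI S U V N1 N2 (c : 'I_N1 -> 'M[C]_(r, n))
    (b : 'I_N2 -> 'M[C]_(r, n)) :
  splitting U V -> kills b V -> kills c U -> tensor_factor S c b ->
  typeI S (fun c => 0 <= c) U V.
Proof.
move=> UV bV cU Sf; split=> // [u Uu _|u v Uu _ Vv _|v Vv _].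
- by rewrite (tensor_form_factor_ge0 Sf (kills_tensor cU Uu)).
- rewrite (tensor_form_factor _ Sf (kills_tensor cU Uu)) big1 // => p _.
  by rewrite (kills_tensor bV Vv) linear0 conjC0 mulr0.
- by rewrite (tensor_form_factor_ge0 (tensor_factor_tr Sf) (kills_tensor bV Vv)).
Qed.

(** By the equality case for sums of squares, definiteness on a subspace means that the linear forms
    have no common non-zero zero there. *)
Lemma factor_typeI_gt0 S U V N1 N2 (c : 'I_N1 -> 'M[C]_(r, n))
    (b : 'I_N2 -> 'M[C]_(r, n)) :
  splitting U V -> kills b V -> kills c U -> tensor_factor S c b ->
  typeI S (fun c => 0 < c) U V <-> nondegenerate b U /\ nondegenerate c V.
Proof.
move=> UV bV cU Sf.
have [_ _ cross _] := factor_typeI UV bV cU Sf.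
(* Stated for any tensor and subspace, to serve for [S] on [U] and for its transpose on [V]. *)
have posP S' N N' (c' : 'I_N -> 'M[C]_(r, n)) (b' : 'I_N' -> 'M[C]_(r, n)) W :
    kills c' W -> tensor_factor S' c' b' ->
    (forall u, in_tensor W u -> u != 0 -> 0 < tensor_form S' u u) <->
    nondegenerate b' W.
  move=> cW S'f; split=> h u Wu => [b0|u0].
    apply/eqP; apply: contraT => /(h _ Wu).
    rewrite (tensor_form_factor _ S'f (kills_tensor cW Wu)) big1 ?ltxx // => p _.
    by rewrite b0 mul0r.
  have F := tensor_form_factor_ge0 S'f (kills_tensor cW Wu).
  rewrite lt_neqAle !F andbT; apply: contra u0 => /forallP b0.
  by apply/eqP/h => // p; exact/eqP.
split=> [[_ Upos _ Vpos]|[bU cV]].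
  by split; [apply/(posP S)|apply/(posP (tensor_tr S))]; eauto using tensor_factor_tr.
split=> //; first exact/(posP S _ _ c b U cU Sf).
exact/(posP _ _ _ b c V bV (tensor_factor_tr Sf)).
Qed.

(** Transformation law of the two lower bundle indices when the columns of [P] hold the new
    frame. *)
Definition tensor_frame S P a b : 'M[C]_r := P^T *m S a b *m map_mx Num.conj P.

Lemma tensor_form_frame S P u v :
  tensor_form (tensor_frame S P) u v = tensor_form S (P *m u) (P *m v).
Proof.
have E T x y : tensor_form T x y =
    \sum_a \sum_b (x^T *m T a b *m map_mx Num.conj y) a b.
  rewrite /tensor_form.
  under eq_bigr => i _ do rewrite exchange_big /=.
  rewrite exchange_big /=; apply: eq_bigr => a _.
  under eq_bigr => i _ do rewrite exchange_big /=.
  rewrite exchange_big /=; apply: eq_bigr => b _.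
  rewrite exchange_big mxE; apply: eq_bigr => j _; rewrite !mxE mulr_suml.
  by apply: eq_bigr => i _; rewrite !mxE [x _ _ * _]mulrC.
rewrite !E; apply: eq_bigr => a _; apply: eq_bigr => b _.
by rewrite /tensor_frame trmx_mul map_mxM !mulmxA.
Qed.

(** Transposition exchanges the linear and the conjugate-linear bundle index, so [P] is replaced by
    its conjugate. *)
Lemma tensor_tr_frame S P a b :
  tensor_tr (tensor_frame S P) a b =
  tensor_frame (tensor_tr S) (map_mx Num.conj P) a b.
Proof.
rewrite /tensor_tr /tensor_frame !trmx_mul trmxK mulmxA; congr (_ *m _).
by apply/matrixP=> i j; rewrite !mxE conjCK.
Qed.

Lemma tensor_form_eq S S' u v : (forall a b, S a b = S' a b) ->
  tensor_form S u v = tensor_form S' u v.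
Proof.
move=> SS'; apply: eq_bigr => i _; apply: eq_bigr => j _; apply: eq_bigr => a _.
by apply: eq_bigr => b _; rewrite SS'.
Qed.

Lemma in_tensor_mul P U u : in_tensor U u -> in_tensor U (P *m u).
Proof.
move=> Uu i; rewrite row_mul mulmx_sum_row; apply: memv_suml => k _.
exact/memvZ/Uu.
Qed.

(** Left multiplication by [P] mixes only bundle indices: it preserves tensors over each subspace
    and, being injective, non-zero ones. *)
Lemma typeI_frame S P pos U V : P \in unitmx ->
  typeI S pos U V -> typeI (tensor_frame S P) pos U V.
Proof.
move=> Pu [UV Upos cross Vpos].
have P0 Q w : Q \in unitmx -> w != 0 -> Q *m w != 0 :> 'M[C]_(r, n).
  by move=> Qu; apply: contra => /eqP Qw; rewrite -[w](mulKmx Qu) Qw mulmx0.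
split=> // [u Uu u0|u v Uu u0 Vv v0|v Vv v0].
- by rewrite tensor_form_frame; apply: Upos; [exact: in_tensor_mul|exact: P0].
- by rewrite tensor_form_frame; apply: cross; do ?[exact: in_tensor_mul|exact: P0].
- rewrite (tensor_form_eq _ _ (tensor_tr_frame S P)) tensor_form_frame.
  by apply: Vpos; [exact: in_tensor_mul|apply: P0; rewrite ?map_unitmx].
Qed.

Lemma tensor_herm_frame S P : tensor_herm S -> tensor_herm (tensor_frame S P).
Proof.
move=> Sh a b i j.
have E T c d k l : tensor_frame T P c d k l =
    \sum_p \sum_q P p k * T c d p q * (P q l)^*.
  rewrite /tensor_frame mxE exchange_big; apply: eq_bigr => q _ /=.
  by rewrite !mxE mulr_suml; apply: eq_bigr => p _; rewrite !mxE.
rewrite !E rmorph_sum exchange_big; apply: eq_bigr => q _ /=.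
rewrite rmorph_sum; apply: eq_bigr => p _.
by rewrite !rmorphM /= conjCK Sh mulrC mulrA mulrAC.
Qed.

Lemma typeI_frameP S P pos U V : P \in unitmx ->
  typeI (tensor_frame S P) pos U V <-> typeI S pos U V.
Proof.
move=> Pu; split; last exact: typeI_frame.
have Piu : invmx P \in unitmx by rewrite unitmx_inv.
move=> /(typeI_frame Piu); congr typeI; apply/funext=> a; apply/funext=> b.
rewrite /tensor_frame -!mulmxA -map_mxM mulmxV // map_mx1 mulmx1 mulmxA -trmx_mul.
by rewrite mulmxV // trmx1 mul1mx.
Qed.

End TypeI.

(** * Symmetry of second derivatives *)

Section Schwarz.
Variable R : realType.

Lemma is_derive_mvt (f df : R -> R) (h : R) : 0 < h ->
  (forall s, 0 <= s <= h -> is_derive s 1 f (df s)) ->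
  exists2 c, 0 <= c <= h & f h - f 0 = df c * h.
Proof.
move=> h0 fd; have [||c] := @MVT R f df 0 h h0.
- by move=> s /itvP sh; apply: fd; rewrite !sh.
- apply: derivable_within_continuous => s; rewrite in_itv /= => sh.
  by have [] := fd _ sh.
by move=> /itvP ch; rewrite subr0 => ->; exists c; rewrite ?ch.
Qed.

(** The mean value theorem is applied in [s] to [g s h - g s 0], then in [t] to [gs s]. *)
Lemma second_difference_mvt (g gs gst : R -> R -> R) (h : R) : 0 < h ->
  (forall s t, 0 <= s <= h -> 0 <= t <= h -> is_derive s 1 (g^~ t) (gs s t)) ->
  (forall s t, 0 <= s <= h -> 0 <= t <= h -> is_derive t 1 (gs s) (gst s t)) ->
  exists s t, [/\ 0 <= s <= h, 0 <= t <= h &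
    g h h - g h 0 - (g 0 h - g 0 0) = gst s t * h * h].
Proof.
move=> h0 dg dgs.
have hh : 0 <= h <= h by rewrite ltW /=.
have h00 : 0 <= (0 : R) <= h by rewrite lexx ltW.
have [|s sh E] := @is_derive_mvt (fun s => g s h - g s 0) (fun s => gs s h - gs s 0) h h0.
  by move=> s sh; apply: is_deriveB; exact: dg.
have [|t th E'] := @is_derive_mvt (gs s) (gst s) h h0; first by move=> t; exact: dgs.
by exists s, t; split=> //; rewrite E E'.
Qed.

(* Both values are the second difference of g on the square, divided by h^2. *)
Lemma mixed_derivatives_mvt (g gs gt gst gts : R -> R -> R) (h : R) : 0 < h ->
  (forall s t, 0 <= s <= h -> 0 <= t <= h -> is_derive s 1 (g^~ t) (gs s t)) ->
  (forall s t, 0 <= s <= h -> 0 <= t <= h -> is_derive t 1 (gs s) (gst s t)) ->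
  (forall s t, 0 <= s <= h -> 0 <= t <= h -> is_derive t 1 (g s) (gt s t)) ->
  (forall s t, 0 <= s <= h -> 0 <= t <= h -> is_derive s 1 (gt^~ t) (gts s t)) ->
  exists s t s' t', [/\ 0 <= s <= h /\ 0 <= t <= h,
    0 <= s' <= h /\ 0 <= t' <= h & gst s t = gts s' t'].
Proof.
move=> h0 ds dst dt dts.
have [s [t [sh th E]]] := second_difference_mvt h0 ds dst.
have [t' [s' [th' sh' E']]] := @second_difference_mvt (fun t s => g s t)
  (fun t s => gt s t) (fun t s => gts s t) h h0
  (fun t s th sh => dt s t sh th) (fun t s th sh => dts s t sh th).
exists s, t, s', t'; split=> //.
have hn0 : h != 0 by rewrite gt_eqF.
by apply: (mulIf hn0); apply: (mulIf hn0); rewrite -E -E'; ring.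
Qed.

Lemma dist_le_half (a b x y e : R) :
  `|a - x| < e / 2 -> `|b - y| < e / 2 -> x = y -> `|a - b| <= e.
Proof.
move=> ax /[swap] <- bx; rewrite -(subrKA x) (le_trans (ler_normD _ _)) //.
by rewrite [leRHS]splitr lerD // ltW // distrC.
Qed.

Variable n : nat.
Local Notation C := (complex R).
Implicit Types (phi : 'rV[C]_n -> R) (f : 'rV[C]_n -> C) (u v w z : 'rV[C]_n) (D : set 'rV[C]_n).

Definition along phi v z (t : R) : R := phi (z + (t%:C)%C *: v).
Definition dirderiv v phi z : R := 'D_1 (along phi v z) 0.

Lemma is_derive_shift (k l : R -> R) (s : R) :
  (forall h, l (h + s) = k h) -> derivable k 0 1 -> is_derive s 1 l ('D_1 k 0).
Proof.
move=> lk.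
suff E : (fun h : R => h^-1 *: ((l \o shift s) (h *: 1) - l s)) =
         (fun h : R => h^-1 *: ((k \o shift 0) (h *: 1) - k 0)).
  by move=> kd; constructor; rewrite /derivable /derive E.
by apply/funext=> h /=; rewrite lk addr0 -(lk 0) add0r.
Qed.

Lemma is_derive_along phi v z s : derivable (along phi v (z + (s%:C)%C *: v)) 0 1 ->
  is_derive s 1 (along phi v z) (dirderiv v phi (z + (s%:C)%C *: v)).
Proof.
apply: is_derive_shift => h.
by rewrite /along [h + s]addrC rmorphD scalerDl addrA.
Qed.

(** The norm of a complex vector is an element of the complex field, so real radii are obtained as
    real parts. *)
Lemma nbhs_plane (A : set 'rV[C]_n) z u v : nbhs z A ->
  exists2 d : R, 0 < d & forall s t : R, `|s| <= d -> `|t| <= d ->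
    A (z + (s%:C)%C *: u + (t%:C)%C *: v).
Proof.
move=> /nbhs_ballP[e /= e0 eA].
have eE : e = ((complex.Re e)%:C)%C by rewrite RRe_real // gtr0_real.
have re0 : 0 < complex.Re e by rewrite eE ltcR in e0.
pose M := `|u| + `|v| : C.
have M0 : 0 <= M by exact: addr_ge0.
have ME : M = ((complex.Re M)%:C)%C by rewrite RRe_real // ger0_real.
have rM0 : 0 <= complex.Re M by rewrite ME ler0c in M0.
(* Adding one keeps the denominator positive and makes [d] times [M] strictly smaller than the
   radius. *)
pose d := complex.Re e / (complex.Re M + 1).
have d0 : 0 < d by rewrite divr_gt0 // ltr_wpDl.
exists d => //.
move=> s t sd td; apply: eA; rewrite -ball_normE /= -addrA opprD addrA subrr sub0r normrN.
apply: le_lt_trans (ler_normD _ _) _; rewrite !normrZ.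
have nE (x : R) : `|(x%:C)%C| = (`|x|%:C)%C :> C.
  by rewrite normc_def /= expr0n addr0 sqrtr_sqr.
rewrite !nE.
apply: (@le_lt_trans _ _ ((d%:C)%C * M)).
  by rewrite mulrDr; apply: lerD; apply: ler_wpM2r => //; rewrite lecR.
rewrite ME eE -rmorphM /= ltcR /d -mulrA gtr_pMr // mulrC ltr_pdivrMr ?mul1r ?ltrDl //.
by rewrite ltr_wpDl.
Qed.

(** On a small square spanned by [u] and [v] the two mixed derivatives share a value, at possibly
    different points; by continuity it is close to both values at [z]. *)
Theorem dirderiv_comm D phi u v z : open D -> D z ->
  (forall w, D w -> derivable (along phi u w) 0 1) ->
  (forall w, D w -> derivable (along phi v w) 0 1) ->
  (forall w, D w -> derivable (along (dirderiv u phi) v w) 0 1) ->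
  (forall w, D w -> derivable (along (dirderiv v phi) u w) 0 1) ->
  {for z, continuous (dirderiv v (dirderiv u phi))} ->
  {for z, continuous (dirderiv u (dirderiv v phi))} ->
  dirderiv v (dirderiv u phi) z = dirderiv u (dirderiv v phi) z.
Proof.
move=> oD Dz du dv dvu duv cvu cuv.
set a := dirderiv v _ z; set b := dirderiv u _ z.
apply/eqP; rewrite -subr_eq0 -normr_le0; apply/ler_addgt0Pr => e e0; rewrite add0r.
have e20 : 0 < e / 2 by rewrite divr_gt0.
have nD : nbhs z D by exact: open_nbhs_nbhs.
have nvu : nbhs z [set w | `|a - dirderiv v (dirderiv u phi) w| < e / 2].
  by move/cvgrPdist_lt: cvu => /(_ _ e20).
have nuv : nbhs z [set w | `|b - dirderiv u (dirderiv v phi) w| < e / 2].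
  by move/cvgrPdist_lt: cuv => /(_ _ e20).
(* The side [h] keeps the square inside [D] and both mixed derivatives within [e / 2] of their
   values at [z]. *)
have [h h0 hP] := nbhs_plane u v (filterI nD (filterI nvu nuv)).
have nh s : 0 <= s <= h -> `|s| <= h by case/andP=> s0 sh; rewrite ger0_norm.
pose g s t := phi (z + (s%:C)%C *: u + (t%:C)%C *: v).
pose p s t := z + (s%:C)%C *: u + (t%:C)%C *: v : 'rV[C]_n.
have pC s t : p s t = z + (t%:C)%C *: v + (s%:C)%C *: u by rewrite /p addrAC.
have [||||s [t [s' [t' [[sh th] [sh' th'] E]]]]] := @mixed_derivatives_mvt
  (fun s t => phi (p s t)) (fun s t => dirderiv u phi (p s t))
  (fun s t => dirderiv v phi (p s t))
  (fun s t => dirderiv v (dirderiv u phi) (p s t))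
  (fun s t => dirderiv u (dirderiv v phi) (p s t)) h h0.
- move=> s t /nh sh /nh th; under eq_fun do rewrite pC; rewrite pC.
  by apply: is_derive_along; apply: du; have [+ _] := hP s t sh th; rewrite -pC.
- move=> s t /nh sh /nh th.
  by apply: is_derive_along; apply: dvu; have [] := hP s t sh th.
- move=> s t /nh sh /nh th.
  by apply: is_derive_along; apply: dv; have [] := hP s t sh th.
- move=> s t /nh sh /nh th; under eq_fun do rewrite pC; rewrite pC.
  by apply: is_derive_along; apply: duv; have [+ _] := hP s t sh th; rewrite -pC.
have [_ [near_a _]] := hP _ _ (nh _ sh) (nh _ th).
have [_ [_ near_b]] := hP _ _ (nh _ sh') (nh _ th').
exact: dist_le_half near_a near_b E.
Qed.
End Schwarz.

(** * Complex-valued derivatives and their conjugates *)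

Section WirtingerDerivatives.
Variables (R : realType) (n : nat).
Local Notation C := (complex R).
Implicit Types (f g : 'rV[C]_n -> C) (u v w z : 'rV[C]_n) (D : set 'rV[C]_n).

(** The four terms are those of the real or imaginary part in [complex_lin]. *)
Lemma is_derive_lin4 (a b c d : R) (F G H K : R -> R) (F' G' H' K' : R) :
  is_derive (0 : R) 1 F F' -> is_derive (0 : R) 1 G G' ->
  is_derive (0 : R) 1 H H' -> is_derive (0 : R) 1 K K' ->
  is_derive (0 : R) 1 (fun t => (a * F t + b * G t) + (c * H t + d * K t))
    ((a * F' + b * G') + (c * H' + d * K')).
Proof.
move=> dF dG dH dK.
exact: (is_deriveD (is_deriveD (is_deriveZ a dF) (is_deriveZ b dG))
  (is_deriveD (is_deriveZ c dH) (is_deriveZ d dK))).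
Qed.

Lemma complex_lin (a b : C) (x y : C) : a * x + b * y =
  ((complex.Re a * complex.Re x + - complex.Im a * complex.Im x +
    (complex.Re b * complex.Re y + - complex.Im b * complex.Im y)) +i*
   (complex.Re a * complex.Im x + complex.Im a * complex.Re x +
    (complex.Re b * complex.Im y + complex.Im b * complex.Re y)))%C.
Proof. by case: a b x y => ? ? [? ?] [? ?] [? ?]; rewrite !mulNr. Qed.

Lemma real_deriv_lin (a b : C) f g v z :
  real_derivable f v z -> real_derivable g v z ->
  real_deriv v (fun w => a * f w + b * g w) z =
  a * real_deriv v f z + b * real_deriv v g z.
Proof.
move=> [/derivableP fr /derivableP fi] [/derivableP gr /derivableP gi].
rewrite [RHS]complex_lin /real_deriv; congr (_ +i* _)%C.
  have [_ E] := is_derive_lin4 (complex.Re a) (- complex.Im a) (complex.Re b)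
    (- complex.Im b) fr fi gr gi.
  apply: etrans E; apply: (congr1 (fun F : R -> R => 'D_(1 : R) F (0 : R))).
  by apply/funext=> t; rewrite /line_re /line_im complex_lin.
have [_ E] := is_derive_lin4 (complex.Re a) (complex.Im a) (complex.Re b)
  (complex.Im b) fi fr gi gr.
apply: etrans E; apply: (congr1 (fun F : R -> R => 'D_(1 : R) F (0 : R))).
by apply/funext=> t; rewrite /line_re /line_im complex_lin.
Qed.

Lemma real_deriv_conj f v z : real_derivable f v z ->
  real_deriv v (fun w => (f w)^*) z = (real_deriv v f z)^*.
Proof.
move=> [_ /derivableP/is_deriveN[_ fi]].
rewrite [RHS]/Num.conj /real_deriv /= -fi; congr (_ +i* _)%C.
  rewrite (_ : line_re _ v z = line_re f v z) //.
  by apply/funext=> t; rewrite /line_re; case: (f _).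
rewrite (_ : line_im _ v z = - line_im f v z) //.
by apply/funext=> t; rewrite /line_im fctE; case: (f _).
Qed.

Lemma near_line D v z : open D -> D z ->
  \forall t \near (0 : R), D (z + (t%:C)%C *: v).
Proof.
move=> oD Dz; have [|d d0 dD] := nbhs_plane v 0 (A := D) (z := z).
  exact: open_nbhs_nbhs.
apply/nbhs_ballP; exists d => //= t; rewrite -ball_normE /= sub0r normrN => td.
rewrite -[z + _]addr0 -(scaler0 _ ((0:R)%:C)%C).
by apply: dD; rewrite ?normr0 ltW.
Qed.

Lemma real_deriv_eq D f g v z : open D -> D z -> (forall w, D w -> f w = g w) ->
  real_deriv v f z = real_deriv v g z.
Proof.
move=> oD Dz fg; have nD := near_line v oD Dz.
rewrite /real_deriv; congr (_ +i* _)%C; apply: near_eq_derive;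
  by apply: filterS nD => t Dt; rewrite /line_re /line_im fg.
Qed.

Lemma continuous_real_part (T : topologicalType) (F : T -> C) (x : T) (part : C -> R) :
  (forall c d, part (c - d) = part c - part d) ->
  (forall c, (`|part c|%:C)%C <= `|c|) ->
  {for x, continuous F} -> {for x, continuous (part \o F)}.
Proof.
move=> partB part_le /cvgrPdist_lt cF; apply/cvgrPdist_lt => e e0.
have e0C : 0 < (e%:C)%C :> C by rewrite ltcR.
apply: filterS (cF _ e0C) => y /= xy.
by rewrite -ltcR (le_lt_trans _ xy) // -partB.
Qed.

Lemma continuous_Re_comp (T : topologicalType) (F : T -> C) (x : T) :
  {for x, continuous F} -> {for x, continuous (@complex.Re R \o F)}.
Proof.
apply: continuous_real_part; first by case=> ? ? [].
by move=> c; exact: normc_ge_Re.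
Qed.

Lemma continuous_Im_comp (T : topologicalType) (F : T -> C) (x : T) :
  {for x, continuous F} -> {for x, continuous (@complex.Im R \o F)}.
Proof.
apply: continuous_real_part; first by case=> ? ? [].
(* Multiplication by a number of modulus one reduces the bound to that for the real part. *)
move=> c; have -> : complex.Im c = - complex.Re (c * 'i%C) by rewrite ReiNIm opprK.
rewrite normrN (le_trans (normc_ge_Re _)) // normrM.
by rewrite [X in _ * X]normc_def /= expr0n expr1n add0r sqrtr1 mulr1.
Qed.

Lemma real_derivE f v z : real_deriv v f z =
  (dirderiv v (@complex.Re R \o f) z +i* dirderiv v (@complex.Im R \o f) z)%C.
Proof. by []. Qed.

Lemma Re_real_deriv f v :
  @complex.Re R \o real_deriv v f = dirderiv v (@complex.Re R \o f).
Proof. by []. Qed.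

Lemma Im_real_deriv f v :
  @complex.Im R \o real_deriv v f = dirderiv v (@complex.Im R \o f).
Proof. by []. Qed.

Lemma derivable_along_Re f v z :
  real_derivable f v z -> derivable (along (@complex.Re R \o f) v z) 0 1.
Proof. by move=> [d _]; exact: d. Qed.

Lemma derivable_along_Im f v z :
  real_derivable f v z -> derivable (along (@complex.Im R \o f) v z) 0 1.
Proof. by move=> [_ d]; exact: d. Qed.

(** The real symmetry theorem is applied to real and imaginary parts; [Ck 2] supplies continuity of
    the second derivatives. *)
Lemma real_deriv_comm D f u v z : open D -> D z -> Ck 2 D f ->
  real_deriv v (real_deriv u f) z = real_deriv u (real_deriv v f) z.
Proof.
move=> oD Dz [_ fD].
have [fu [_ /(_ v)[fuv [cuv _]]]] := fD u.
have [fv [_ /(_ u)[fvu [cvu _]]]] := fD v.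
rewrite (real_derivE (real_deriv u f)) (real_derivE (real_deriv v f)).
have reuv := continuous_Re_comp (cuv z Dz); rewrite !Re_real_deriv in reuv.
have revu := continuous_Re_comp (cvu z Dz); rewrite !Re_real_deriv in revu.
have imuv := continuous_Im_comp (cuv z Dz); rewrite !Im_real_deriv in imuv.
have imvu := continuous_Im_comp (cvu z Dz); rewrite !Im_real_deriv in imvu.
rewrite !Re_real_deriv !Im_real_deriv.
rewrite (dirderiv_comm oD Dz _ _ _ _ reuv revu); first last.
- by move=> w /fvu/derivable_along_Re; rewrite Re_real_deriv.
- by move=> w /fuv/derivable_along_Re; rewrite Re_real_deriv.
- by move=> w /fv/derivable_along_Re.
- by move=> w /fu/derivable_along_Re.
rewrite (dirderiv_comm oD Dz _ _ _ _ imuv imvu); first reflexivity.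
- by move=> w /fu/derivable_along_Im.
- by move=> w /fv/derivable_along_Im.
- by move=> w /fuv/derivable_along_Im; rewrite Im_real_deriv.
- by move=> w /fvu/derivable_along_Im; rewrite Im_real_deriv.
Qed.

Lemma conj_ii : (ii R)^* = - ii R.
Proof. by apply/eqP; rewrite eq_complex /= oppr0 !eqxx. Qed.

Lemma conj_half : (2^-1 : C)^* = 2^-1.
Proof. by rewrite fmorphV /= conjC_nat. Qed.

Lemma conj_del a f z : (forall v, real_derivable f v z) ->
  (del a f z)^* = delbar a (fun w => (f w)^*) z.
Proof.
move=> fd; rewrite /del /delbar !real_deriv_conj //.
by rewrite rmorphM rmorphB rmorphM /= conj_ii conj_half mulNr opprK.
Qed.

Lemma conj_delbar a f z : (forall v, real_derivable f v z) ->
  (delbar a f z)^* = del a (fun w => (f w)^*) z.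
Proof.
move=> fd; rewrite /del /delbar !real_deriv_conj //.
by rewrite rmorphM rmorphD rmorphM /= conj_ii conj_half mulNr.
Qed.

Lemma real_deriv_lin2 D f (k l : C) p q v z : D z -> Ck 2 D f ->
  real_deriv v (fun w => k * (real_deriv p f w + l * real_deriv q f w)) z =
  k * real_deriv v (real_deriv p f) z + k * l * real_deriv v (real_deriv q f) z.
Proof.
move=> Dz [_ fD].
have [_ [_ /(_ v)[d1 _]]] := fD p.
have [_ [_ /(_ v)[d2 _]]] := fD q.
rewrite -real_deriv_lin; [|exact: d1|exact: d2].
apply: (congr1 (fun F => real_deriv v F z)); apply/funext=> w.
by rewrite mulrDr mulrA.
Qed.

Lemma real_deriv_comm_conj D f p p' z : open D -> D z ->
  Ck 2 D f -> Ck 2 D (fun w => (f w)^*) ->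
  real_deriv p' (real_deriv p (fun w => (f w)^*)) z =
  (real_deriv p (real_deriv p' f) z)^*.
Proof.
move=> oD Dz fD gD; rewrite (real_deriv_comm p' p oD Dz fD).
have [_ /(_ p)[fu [_ /(_ p')[fuv _]]]] := fD.
rewrite -real_deriv_conj; last exact: fuv.
by apply: (real_deriv_eq p' oD Dz) => w Dw; rewrite real_deriv_conj //; exact: fu.
Qed.

(* With k = 1/2 and q = i p, q' = i p' this is conj_del_delbar. *)
Lemma conj_mixed_deriv D f p q p' q' (i k : C) z :
  open D -> D z -> Ck 2 D f -> Ck 2 D (fun w => (f w)^*) ->
  i^* = - i -> k^* = k ->
  (k * (real_deriv p (fun w => k * (real_deriv p' f w + i * real_deriv q' f w)) z -
    i * real_deriv q (fun w => k * (real_deriv p' f w + i * real_deriv q' f w)) z))^* =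
  k * (real_deriv p' (fun w => k * (real_deriv p (fun w => (f w)^*) w +
         i * real_deriv q (fun w => (f w)^*) w)) z -
    i * real_deriv q' (fun w => k * (real_deriv p (fun w => (f w)^*) w +
         i * real_deriv q (fun w => (f w)^*) w)) z).
Proof.
move=> oD Dz fD gD ic kc.
rewrite (real_deriv_lin2 k i p' q' p Dz fD) (real_deriv_lin2 k i p' q' q Dz fD).
rewrite (real_deriv_lin2 k i p q p' Dz gD) (real_deriv_lin2 k i p q q' Dz gD).
(* This leaves four second derivatives of [f], and the claim becomes a polynomial identity in their
   conjugates. *)
have conj2 u v := real_deriv_comm_conj u v oD Dz fD gD.
rewrite (conj2 p p') (conj2 p q') (conj2 q p') (conj2 q q').
move: (real_deriv p (real_deriv p' f) z) (real_deriv p (real_deriv q' f) z) => x y.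
move: (real_deriv q (real_deriv p' f) z) (real_deriv q (real_deriv q' f) z) => s t.
rewrite !(rmorphM, rmorphB, rmorphD) /= ic kc.
move: (x^*) (y^*) (s^*) (t^*) => {}x {}y {}s {}t.
by ring.
Qed.

Lemma conj_del_delbar D f a b z : open D -> D z ->
  Ck 2 D f -> Ck 2 D (fun w => (f w)^*) ->
  (del a (delbar b f) z)^* = del b (delbar a (fun w => (f w)^*)) z.
Proof.
move=> oD Dz fD gD.
exact: (conj_mixed_deriv _ _ _ _ oD Dz fD gD conj_ii conj_half).
Qed.

End WirtingerDerivatives.

(** * Curvature in frames *)

Section CurvatureSymmetry.
Variables (R : realType) (n : nat) (X : complex_manifold R n) (r : nat).
Variables (E : holo_bundle X r) (h : hermitian_metric E).
Local Notation C := (complex R).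
Variables (k : chart R n X) (e : local_frame r E).

(** The image is the preimage of [A] under the inverse chart, which is continuous on an open set. *)
Lemma chart_image_open (T : topologicalType) (c : chart R n T) (A : set T) :
  open A -> open (ccoord c @` (cdom c `&` A)).
Proof.
move=> oA; have := @cinv_cont _ _ _ c; rewrite (continuous_open_subspace _ (@cimg_open _ _ _ c)).
move/(continuous_inP _ (@cimg_open _ _ _ c))/(_ A oA).
congr open; apply/seteqP; split=> z /=.
  move=> [[x cx <-]]; rewrite (cinvK (mem_set cx)) => Ax.
  by exists x.
move=> [x [cx Ax] <-]; split; first by exists x.
by rewrite (cinvK (mem_set cx)).
Qed.

Lemma conj_gram z i j : (gram h k e z i j)^* = gram h k e z j i.
Proof. by rewrite !mxE -herm_sym. Qed.

Lemma conj_gram_fun i j :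
  (fun w => (gram h k e w i j)^*) = (fun w => gram h k e w j i).
Proof. by apply/funext=> w; exact: conj_gram. Qed.

Lemma conj_invmx_gram z i j :
  (invmx (gram h k e z) i j)^* = invmx (gram h k e z) j i.
Proof.
have G : (map_mx Num.conj (gram h k e z))^T = gram h k e z.
  by apply/matrixP=> a b; rewrite [LHS]mxE [LHS]mxE conj_gram.
by rewrite -[in RHS]G -trmx_inv -map_invmx [RHS]mxE [RHS]mxE.
Qed.

Lemma curvE x a b i j : curv h k e x a b i j =
  - deldelbar_gram h k e a b (ccoord k x) i j +
  (del_gram h k e a (ccoord k x) *m invmx (gram h k e (ccoord k x)) *m
   delbar_gram h k e b (ccoord k x)) i j.
Proof. by rewrite mxE [X in X + _]mxE. Qed.

(** The second-order term is Hermitian by the symmetry of mixed derivatives. In the product term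
    conjugation turns [del_gram] into the transpose of [delbar_gram] and conversely, and the inverse
    Gram matrix is Hermitian. *)
Theorem curv_herm x : holo_chart k -> cdom k x -> holo_frame e -> fdom e x ->
  tensor_herm (curv h k e x).
Proof.
move=> hk kx he ex a b i j.
apply: etrans (congr1 Num.conj (curvE x a b i j)) (etrans _ (esym (curvE x b a j i))).
pose D := ccoord k @` (cdom k `&` fdom e).
have oD : open D by by apply: chart_image_open; exact: fdom_open.
have : D (ccoord k x) by exists x.
move: (ccoord k x) => z Dz.
have sm i' j' l : Ck l D (fun w => gram h k e w i' j').
  have := herm_smooth h hk he i' j' l; congr (Ck _ _ _).
  by apply/funext=> w; rewrite mxE.
have rd i' j' v : real_derivable (fun w => gram h k e w i' j') v z.
  by have [_ /(_ v)[d _]] := sm i' j' 1%N; exact: d.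
rewrite rmorphD rmorphN /=.
congr (- _ + _).
  have dE a' b' i' j' : deldelbar_gram h k e a' b' z i' j' =
      del a' (delbar b' (fun w => gram h k e w i' j')) z by rewrite mxE.
  have sm2 : Ck 2 D (fun w => (gram h k e w i j)^*).
    by have := sm j i 2%N; rewrite conj_gram_fun.
  apply: etrans (congr1 Num.conj (dE a b i j)) (etrans _ (esym (dE b a j i))).
  apply: etrans (conj_del_delbar a b oD Dz (sm i j 2%N) sm2) _.
  exact: (congr1 (fun F => del b (delbar a F) z) (conj_gram_fun i j)).
have conj_del_gram c i' j' : (del_gram h k e c z i' j')^* = delbar_gram h k e c z j' i'.
  rewrite mxE [RHS]mxE -[in RHS](conj_gram_fun i' j').
  by apply: conj_del => v; exact: rd.
have conj_delbar_gram c i' j' : (delbar_gram h k e c z i' j')^* = del_gram h k e c z j' i'.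
  rewrite mxE [RHS]mxE -[in RHS](conj_gram_fun i' j').
  by apply: conj_delbar => v; exact: rd.
move: (del_gram h k e) (delbar_gram h k e) (invmx (gram h k e z))
  conj_del_gram conj_delbar_gram (conj_invmx_gram z).
move=> A A' B conj_del_gram conj_delbar_gram conjB.
rewrite -mulmxA mxE rmorph_sum.
under eq_bigr => l _ do rewrite mxE rmorphM rmorph_sum mulr_sumr /=.
rewrite exchange_big -mulmxA [RHS]mxE; apply: eq_bigr => l _ /=.
rewrite mxE mulr_sumr; apply: eq_bigr => m _.
by rewrite rmorphM /= conj_del_gram conj_delbar_gram conjB mulrC mulrAC mulrC.
Qed.
End CurvatureSymmetry.

(** * Unitary frames and the curvature in them *)

Section UnitaryFrames.
Variables (R : realType) (n : nat) (X : complex_manifold R n) (r : nat).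
Variables (E : holo_bundle X r) (h : hermitian_metric E).
Local Notation C := (complex R).

Definition gram_at (x : X) (e : r.-tuple (E x)) : 'M[C]_r :=
  \matrix_(i, j) h x (tnth e i) (tnth e j).

Lemma herm_suml (x : X) (I : finType) (c : I -> C) (u : I -> E x) w :
  h x (\sum_i c i *: u i) w = \sum_i c i * h x (u i) w.
Proof.
have h0 : h x 0 w = 0.
  by have := herm_linear h w (-1) 0 0; rewrite scaler0 addr0 mulN1r addNr.
elim/big_rec2: _ => // i y s _ <-; exact: herm_linear.
Qed.

Lemma herm_sumr (x : X) (I : finType) (c : I -> C) (u : I -> E x) w :
  h x w (\sum_i c i *: u i) = \sum_i (c i)^* * h x w (u i).
Proof.
rewrite herm_sym herm_suml rmorph_sum; apply: eq_bigr => i _.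
by rewrite rmorphM /= -herm_sym.
Qed.

Lemma gram_comb (x : X) (e f : r.-tuple (E x)) (P : 'M[C]_r) :
  (forall i, tnth f i = \sum_k P k i *: tnth e k) ->
  gram_at f = P^T *m gram_at e *m map_mx Num.conj P.
Proof.
move=> fE; apply/matrixP=> i j; rewrite !mxE !fE herm_sumr; apply: eq_bigr => l _.
rewrite herm_suml mulrC !mxE; congr (_ * _); apply: eq_bigr => k _.
by rewrite !mxE.
Qed.

Lemma change_basisE (K : fieldType) (vT : vectType K) (e f : r.-tuple vT) i :
  basis_of fullv e -> tnth f i = \sum_k change_basis e f k i *: tnth e k.
Proof.
move=> be; rewrite {1}(coord_basis be (memvf (tnth f i))).
by apply: eq_bigr => k _; rewrite mxE -tnth_nth.
Qed.

Lemma unitary_frame_change (x : X) (e f : r.-tuple (E x)) :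
  basis_of fullv e -> unitary_frame h f ->
  let P := change_basis e f in
  P^T *m gram_at e *m map_mx Num.conj P = 1%:M.
Proof.
move=> be [bf uf] P; rewrite -(@gram_comb x e f) => [|i]; last exact: change_basisE.
by apply/matrixP=> i j; rewrite !mxE uf.
Qed.

Lemma conj_gram_at (x : X) (e : r.-tuple (E x)) i j :
  (gram_at e i j)^* = gram_at e j i.
Proof. by rewrite !mxE -herm_sym. Qed.

Lemma gram_at_form (x : X) (e : r.-tuple (E x)) (u : 'rV[C]_r) :
  (u *m gram_at e *m (map_mx Num.conj u)^T) 0 0 =
  h x (\sum_i u 0 i *: tnth e i) (\sum_i u 0 i *: tnth e i).
Proof.
rewrite mxE herm_sumr; apply: eq_bigr => j _; rewrite herm_suml mulrC !mxE.
by congr (_ * _); apply: eq_bigr => i _; rewrite mxE.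
Qed.

Lemma tuple_combination0 (K : fieldType) (vT : vectType K) (e : r.-tuple vT) (c : 'I_r -> K) :
  basis_of fullv e -> \sum_i c i *: tnth e i = 0 -> forall i, c i = 0.
Proof.
move=> /basis_free/freeP fe c0; apply: fe; apply: etrans c0.
by apply: eq_bigr => i _; rewrite -tnth_nth.
Qed.

(** The positive definite Gram matrix is [Q^T] times the conjugate of [Q] with [Q] invertible, and
    the inverse of [Q] orthonormalises the frame. *)
Lemma unitary_frame_exists (x : X) (e : r.-tuple (E x)) :
  basis_of fullv e -> exists f : r.-tuple (E x), unitary_frame h f.
Proof.
move=> be; have [||Q GQ] := @psd_factor _ _ (gram_at e).
- by apply/matrixP=> i j; rewrite [LHS]mxE [X in X^*]mxE conj_gram_at.
- move=> u; rewrite -map_trmx gram_at_form.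
  set v := \sum_i _; have [->|v0] := eqVneq v 0; last exact/ltW/herm_pos.
  have := herm_linear h (0 : E x) (-1) 0 0.
  by rewrite scaler0 addr0 mulN1r addNr => ->.
(* A kernel vector of [Q^T] is one of the Gram matrix, hence zero by definiteness. *)
have Qu : Q \in unitmx.
  have kerG (u : 'rV[C]_r) : u *m gram_at e = 0 -> u = 0.
    move=> uG; apply/rowP=> i; rewrite mxE.
    apply: (tuple_combination0 be (c := fun i => u 0 i)).
    apply/eqP; apply: contraT => /(herm_pos h).
    by rewrite -gram_at_form uG mul0mx mxE ltxx.
  rewrite -unitmx_tr -row_free_unit -kermx_eq0; apply/eqP/row_matrixP=> i.
  rewrite row0; apply: kerG.
  by rewrite GQ mulmxA (sub_kermxP (row_sub i (kermx Q^T))) mul0mx.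
pose P := invmx Q; pose f := [tuple \sum_k P k i *: tnth e k | i < r].
have uf i j : h x (tnth f i) (tnth f j) = (i == j)%:R.
  have /matrixP/(_ i j) : gram_at f = 1%:M.
    rewrite (@gram_comb _ e f P) => [|k]; last by rewrite tnth_mktuple.
    rewrite GQ mulmxA -trmx_mul -mulmxA -map_mxM mulmxV // map_mx1 mulmx1.
    by rewrite trmx1.
  by rewrite !mxE.
exists f; split=> //; rewrite basisEfree subvf (size_basis be) !size_tuple leqnn.
rewrite !andbT.
apply/freeP=> c c0 j.
have cf0 : \sum_i c i *: tnth f i = 0.
  by apply: etrans c0; apply: eq_bigr => i _; rewrite -tnth_nth.
(* Pairing the vanishing combination with [tnth f j] leaves the coefficient [c j]. *)
have := herm_suml c (fun i => tnth f i) (tnth f j); rewrite cf0.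
have -> : h x 0 (tnth f j) = 0.
  by have := herm_linear h (tnth f j) (-1) 0 0; rewrite scaler0 addr0 mulN1r addNr.
rewrite (bigD1 j) //= uf eqxx mulr1 big1 ?addr0 // => i /negPf ij.
by rewrite uf ij mulr0.
Qed.

(** Unitarity makes the inverse Gram matrix the conjugate of [P] times [P^T], so raising an index
    and conjugating by [P] together amount to the law for lower indices. *)
Lemma curv_endo_inE (k : chart R n X) (e : local_frame r E) (x : X)
    (f : r.-tuple (E x)) a b i j :
  cdom k x -> fdom e x -> unitary_frame h f ->
  curv_endo_in h k e f a b j i =
  tensor_frame (curv h k e x) (change_basis (fsec e x) f) a b i j.
Proof.
move=> kx ex uf; have be := fsec_basis ex.
have := unitary_frame_change be uf; set P := change_basis _ _ => /= PG.
have gE : gram h k e (ccoord k x) = gram_at (fsec e x).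
  by rewrite /gram (cinvK (mem_set kx)).
have Pcu : map_mx Num.conj P \in unitmx by case/mulmx1_unit: PG.
have Pu : P \in unitmx by rewrite map_unitmx in Pcu.
have Gi : invmx (gram_at (fsec e x)) = map_mx Num.conj P *m P^T.
  have GP : gram_at (fsec e x) *m (map_mx Num.conj P *m P^T) = 1%:M.
    by rewrite mulmxA; apply: mulmx1C; rewrite mulmxA.
  have [Gu _] := mulmx1_unit GP.
  by rewrite -[RHS](mulKmx Gu) GP mulmx1.
have EP (S : 'M[C]_r) : invmx P *m (S *m invmx (gram_at (fsec e x)))^T *m P =
    (P^T *m S *m map_mx Num.conj P)^T.
  by rewrite Gi !trmx_mul !trmxK -!mulmxA mulKmx.
by rewrite /curv_endo_in /curv_endo gE EP mxE.
Qed.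
End UnitaryFrames.

(** * Matrices of forms *)

Section FormMatrices.
Variables (R : realType) (n r : nat).
Local Notation C := (complex R).
Implicit Types (x y v : 'rV[C]_n) (M : 'M[C]_n) (U V : {vspace 'rV[C]_n}).

(** [A] has this shape and [B] is the conjugate of such a matrix, so both are described by families
    of coefficient matrices. *)
Definition forms10 N (c : 'I_N -> 'M[C]_(r, n)) : 'M[form1 R n]_(r, N) :=
  \matrix_(i, p) row_mx (row i (c p)) 0.

Lemma conj_formK : involutive (@conj_form R n).
Proof.
have conjK m (z : 'rV[C]_m) : map_mx Num.conj (map_mx Num.conj z) = z.
  by apply/rowP=> i; rewrite !mxE conjCK.
by move=> xi; rewrite /conj_form row_mxKl row_mxKr !conjK hsubmxK.
Qed.

Lemma conj_formsK N (M : 'M[form1 R n]_(r, N)) : conj_forms (conj_forms M) = M.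
Proof. by apply/matrixP=> i p; rewrite !mxE conj_formK. Qed.

Lemma conj_form10 x : conj_form (row_mx x 0) = row_mx 0 (map_mx Num.conj x).
Proof. by rewrite /conj_form row_mxKl row_mxKr map_mx0. Qed.

Lemma forms10P N (M : 'M[form1 R n]_(r, N)) :
  (forall i p, is_10 (M i p)) -> exists c, M = forms10 c.
Proof.
move=> M10; exists (fun p => \matrix_i lsubmx (M i p)).
by apply/matrixP=> i p; rewrite mxE rowK -(M10 i p) hsubmxK.
Qed.

Lemma forms01P N (M : 'M[form1 R n]_(r, N)) :
  (forall i p, is_01 (M i p)) -> exists b, M = conj_forms (forms10 b).
Proof.
move=> M01; have [|b bE] := @forms10P _ (conj_forms M).
  by move=> i p; rewrite /is_10 mxE row_mxKr M01 map_mx0.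
by exists b; rewrite -bE conj_formsK.
Qed.

Lemma is_10_forms10 N (c : 'I_N -> 'M[C]_(r, n)) i p : is_10 (forms10 c i p).
Proof. by rewrite /is_10 mxE row_mxKr. Qed.

Lemma is_01_conj_forms10 N (b : 'I_N -> 'M[C]_(r, n)) i p :
  is_01 (conj_forms (forms10 b) i p).
Proof. by rewrite /is_01 !mxE conj_form10 row_mxKl. Qed.

(** The two-form with coefficient [M a b] on the wedge of [dz a] and [dzbar b]. *)
Definition form11 M : 'M[C]_(n + n) := block_mx 0 M (- M^T) 0.

Lemma form11D M M' : form11 (M + M') = form11 M + form11 M'.
Proof. by rewrite /form11 add_block_mx !addr0 linearD opprD. Qed.

Lemma form11_sum (I : finType) (F : I -> 'M[C]_n) :
  form11 (\sum_i F i) = \sum_i form11 (F i).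
Proof.
apply: (big_morph _ form11D).
by rewrite /form11 trmx0 oppr0 block_mx0.
Qed.

Lemma form11Z (a : C) M : form11 (a *: M) = a *: form11 M.
Proof. by rewrite /form11 scale_block_mx !scaler0 linearZ scalerN. Qed.

Lemma form11_inj : injective form11.
Proof. by move=> M M' /eq_block_mx[]. Qed.

Lemma wedge10_01 x y : wedge (row_mx x 0) (row_mx 0 y) = form11 (x^T *m y).
Proof.
rewrite /wedge /form11 !tr_row_mx !trmx0 !mul_col_row !(mul0mx, mulmx0).
by rewrite opp_block_mx add_block_mx !oppr0 !(addr0, add0r) trmx_mul trmxK.
Qed.

Lemma wedgeN (xi eta : form1 R n) : - wedge xi eta = wedge eta xi.
Proof. by rewrite /wedge opprB. Qed.

Lemma wedge_dz a b : wedge (dz R a) (dzbar R b) = form11 (delta_mx a b).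
Proof.
rewrite /dz /dzbar delta_mx_lshift delta_mx_rshift wedge10_01 trmx_delta.
by rewrite mul_delta_mx.
Qed.

Lemma wedge_conjT10 N (c : 'I_N -> 'M[C]_(r, n)) j i :
  wedge_conjT (forms10 c) j i =
  form11 (\sum_p (row j (c p))^T *m map_mx Num.conj (row i (c p))).
Proof.
rewrite mxE form11_sum; apply: eq_bigr => p _.
by rewrite !mxE conj_form10 wedge10_01.
Qed.

(** Antisymmetry of the wedge absorbs the minus sign and puts the (1,0)-forms first, which exchanges
    [i] and [j] relative to [wedge_conjT10]. *)
Lemma wedge_conjT01 N (b : 'I_N -> 'M[C]_(r, n)) j i :
  - wedge_conjT (conj_forms (forms10 b)) j i =
  form11 (\sum_p (row i (b p))^T *m map_mx Num.conj (row j (b p))).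
Proof.
rewrite mxE form11_sum -sumrN; apply: eq_bigr => p _.
by rewrite !mxE conj_formK wedgeN conj_form10 wedge10_01.
Qed.

Lemma sum_wedge_dz M :
  \sum_a \sum_b M a b *: wedge (dz R a) (dzbar R b) = form11 M.
Proof.
rewrite {2}[M]matrix_sum_delta form11_sum; apply: eq_bigr => a _.
rewrite form11_sum; apply: eq_bigr => b _.
by rewrite wedge_dz form11Z.
Qed.

Lemma eval_form10 x v : eval_form (row_mx x 0) (tvec v) = (x *m v^T) 0 0.
Proof. by rewrite /eval_form /tvec tr_row_mx mul_row_col mul0mx addr0. Qed.

Lemma eval_form01 x v :
  eval_form (conj_form (row_mx x 0)) (tvec_bar v) = ((x *m v^T) 0 0)^*.
Proof.
rewrite conj_form10 /eval_form /tvec_bar tr_row_mx mul_row_col mul0mx add0r.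
by rewrite map_trmx -map_mxM mxE.
Qed.

Lemma annihilates10P N (c : 'I_N -> 'M[C]_(r, n)) V :
  (forall i p, annihilates V (forms10 c i p)) <-> kills c V.
Proof.
split=> [h p v Vv|h i p].
  apply/colP=> i; have [_ /(_ v Vv)] := h i p.
  by rewrite [forms10 c i p]mxE eval_form10 -row_mul [LHS]mxE => ->; rewrite mxE.
split=> [|v Vv]; first exact: is_10_forms10.
by rewrite mxE eval_form10 -row_mul (h p v Vv) !mxE.
Qed.

Definition rows_span N (c : 'I_N -> 'M[C]_(r, n)) : {vspace 'rV[C]_n} :=
  (\sum_i \sum_p <[row i (c p)]>)%VS.

Lemma rows_span_kills N (c : 'I_N -> 'M[C]_(r, n)) V :
  kills c V <->
  (forall w v, w \in rows_span c -> v \in V -> w *m v^T = 0).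
Proof.
split=> [h w v cw Vv|h p v Vv].
  suff cK : (rows_span c <= lker (linfun (mulmxr v^T : 'rV[C]_n -> 'M[C]_1)))%VS.
    by move/subvP/(_ w cw): cK; rewrite memv_ker lfunE => /eqP.
  apply/subv_sumP=> i _; apply/subv_sumP=> p _; rewrite -memvE memv_ker lfunE /=.
  by rewrite -row_mul (h p v Vv) row0.
apply/row_matrixP=> i; rewrite row_mul row0; apply: h => //.
by apply: (subvP (sumv_sup i _ (sumv_sup p _ (subvv _)))); rewrite ?memv_line.
Qed.

Definition of_row10 : 'Hom('rV[C]_n, 'rV[C]_(n + n)) :=
  linfun (mulmxr (row_mx 1%:M 0) : 'rV[C]_n -> 'rV[C]_(n + n)).

Lemma of_row10E x : of_row10 x = row_mx x 0.
Proof. by rewrite lfunE /= mul_mx_row mulmx1 mulmx0. Qed.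

Lemma lker_of_row10 : lker of_row10 == 0%VS.
Proof.
by apply/lker0P=> x y; rewrite !of_row10E => /eq_row_mx[].
Qed.

Lemma entries_span10 N (c : 'I_N -> 'M[C]_(r, n)) :
  entries_span (forms10 c) = (of_row10 @: rows_span c)%VS.
Proof.
rewrite /entries_span /rows_span limg_sum; apply: eq_bigr => i _.
rewrite limg_sum; apply: eq_bigr => p _.
by rewrite limg_line of_row10E mxE.
Qed.

(** Injectivity of [of_row10] reduces the claim to row spans, where disjoint spaces of covectors
    correspond to splittings through annihilators. *)
Lemma entries_span10_disjoint N1 N2 (c : 'I_N1 -> 'M[C]_(r, n))
    (b : 'I_N2 -> 'M[C]_(r, n)) :
  (entries_span (forms10 b) :&: entries_span (forms10 c) = 0)%VS <->
  exists U V, [/\ splitting U V, kills b V & kills c U].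
Proof.
have -> : (entries_span (forms10 b) :&: entries_span (forms10 c) = 0)%VS <->
    (rows_span b :&: rows_span c = 0)%VS.
  rewrite !entries_span10 -(lker0_img_cap _ _ lker_of_row10).
  split=> [/eqP|->]; last exact: limg0.
  by rewrite -subv0 -(limg0 of_row10) (limg_ker0 _ _ lker_of_row10) subv0 => /eqP.
split=> [/splitting_annihilators[U [V [UV bV cU]]]|[U [V [UV bV cU]]]].
  by exists U, V; split=> //; apply/rows_span_kills.
by apply: splitting_annihilators_disjoint UV _ _; apply/rows_span_kills.
Qed.

Lemma eval_forms10 N (c : 'I_N -> 'M[C]_(r, n)) i p v :
  eval_form (forms10 c i p) (tvec v) = (row i (c p) *m v^T) 0 0.
Proof. by rewrite mxE eval_form10. Qed.

Lemma eval_forms01 N (b : 'I_N -> 'M[C]_(r, n)) i p v :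
  eval_form (conj_forms (forms10 b) i p) (tvec_bar v) =
  (eval_form (forms10 b i p) (tvec v))^*.
Proof. by rewrite [conj_forms _ _ _]mxE [forms10 _ _ _]mxE eval_form01 eval_form10. Qed.

Lemma coef_mx_conj_forms N d (t : d.-tuple 'rV[C]_n) (b : 'I_N -> 'M[C]_(r, n)) :
  coef_mx_bar t (conj_forms (forms10 b)) =
  map_mx Num.conj (coef_mx t (forms10 b)).
Proof.
apply/row_matrixP=> p; rewrite rowK -map_row rowK map_mxvec; congr mxvec.
by apply/matrixP=> i a; rewrite [LHS]mxE eval_forms01 [RHS]mxE [X in _ = X^*]mxE.
Qed.

Lemma rank_coef_mx N d (t : d.-tuple 'rV[C]_n) U (c : 'I_N -> 'M[C]_(r, n)) :
  basis_of U t ->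
  (\rank (coef_mx t (forms10 c)) = (r * d)%N <-> nondegenerate c U).
Proof.
move=> /(rank_evaluationP c); suff -> : coef_mx t (forms10 c) =
  \matrix_p mxvec (\matrix_(i, a) (row i (c p) *m (tnth t a)^T) 0 0) by [].
apply/row_matrixP=> p; rewrite !rowK; congr mxvec; apply/matrixP=> i a.
by rewrite [LHS]mxE [RHS]mxE eval_forms10.
Qed.

(** The coefficients are the conjugates of those of the (1,0)-forms, and entrywise conjugation
    preserves rank. *)
Lemma rank_coef_mx_bar N d (t : d.-tuple 'rV[C]_n) U (b : 'I_N -> 'M[C]_(r, n)) :
  basis_of U t ->
  (\rank (coef_mx_bar t (conj_forms (forms10 b))) = (r * d)%N <->
   nondegenerate b U).
Proof. by rewrite coef_mx_conj_forms mxrank_map; exact: rank_coef_mx. Qed.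

End FormMatrices.

(** * Curvature factorizations at a point *)

Section Factorization.
Variables (R : realType) (n : nat) (X : complex_manifold R n) (r : nat).
Variables (E : holo_bundle X r) (h : hermitian_metric E).
Local Notation C := (complex R).
Variables (k : chart R n X) (e : local_frame r E) (x : X).
Hypotheses (hk : holo_chart k) (kx : cdom k x) (he : holo_frame e) (ex : fdom e x).

Lemma curvature_matrixE (f : r.-tuple (E x)) j i : unitary_frame h f ->
  curvature_matrix h k e f j i =
  form11 (slice (tensor_frame (curv h k e x) (change_basis (fsec e x) f)) i j).
Proof.
move=> uf; rewrite -sum_wedge_dz mxE; apply: eq_bigr => a _; apply: eq_bigr => b _.
by rewrite [slice _ _ _ _ _]mxE curv_endo_inE.
Qed.

(** All entries are (1,1)-forms and [form11] is injective, so the equation can be tested on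
    coefficients. *)
Lemma curvature_matrix_factorP (f : r.-tuple (E x)) N1 N2
    (c : 'I_N1 -> 'M[C]_(r, n)) (b : 'I_N2 -> 'M[C]_(r, n)) :
  unitary_frame h f ->
  curvature_matrix h k e f =
    - wedge_conjT (conj_forms (forms10 b)) + wedge_conjT (forms10 c) <->
  tensor_factor
    (tensor_frame (curv h k e x) (change_basis (fsec e x) f)) c b.
Proof.
move=> uf; set T := tensor_frame _ _.
pose F i j := \sum_p (row i (b p))^T *m map_mx Num.conj (row j (b p)) +
  \sum_p (row j (c p))^T *m map_mx Num.conj (row i (c p)).
have FE i j a a' : F i j a a' = \sum_p b p i a * (b p j a')^* +
    \sum_p c p j a * (c p i a')^*.
  rewrite mxE !summxE; congr (_ + _); apply: eq_bigr => p _;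
    by rewrite mxE big_ord1 !mxE.
have RE j i : (- wedge_conjT (conj_forms (forms10 b)) + wedge_conjT (forms10 c)) j i =
    form11 (F i j).
  by rewrite mxE [X in X + _]mxE wedge_conjT01 wedge_conjT10 -form11D.
split=> [eqM a a' i j|Tf].
  have : curvature_matrix h k e f j i = form11 (F i j) by rewrite eqM RE.
  rewrite curvature_matrixE // => /form11_inj/matrixP/(_ a a').
  by rewrite mxE FE.
apply/matrixP=> j i; rewrite RE curvature_matrixE //; congr form11.
by apply/matrixP=> a a'; rewrite mxE FE Tf.
Qed.

Lemma change_basis_unit (f : r.-tuple (E x)) : unitary_frame h f ->
  change_basis (fsec e x) f \in unitmx.
Proof.
move=> uf; have /mulmx1_unit[_] := unitary_frame_change (fsec_basis ex) uf.
by rewrite map_unitmx.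
Qed.

Lemma curvature_factorizationP (f : r.-tuple (E x)) N1 N2
    (c : 'I_N1 -> 'M[C]_(r, n)) (b : 'I_N2 -> 'M[C]_(r, n)) :
  curvature_factorization h k e f (conj_forms (forms10 b)) (forms10 c) <->
  [/\ unitary_frame h f,
      tensor_factor (tensor_frame (curv h k e x) (change_basis (fsec e x) f)) c b
    & exists U V, [/\ splitting U V, kills b V & kills c U]].
Proof.
split=> [[uf _ /(curvature_matrix_factorP _ _ uf) Tf]|[uf Tf disj]].
  by rewrite conj_formsK => /entries_span10_disjoint.
split=> //; last by rewrite conj_formsK; apply/entries_span10_disjoint.
  by split=> i p; [exact: is_01_conj_forms10|exact: is_10_forms10].
exact/curvature_matrix_factorP.
Qed.

(** The type I condition does not depend on the frame; in a unitary one it amounts to a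
    factorization adapted to the splitting. *)
Lemma nonnegative_factorization :
  (exists U V, typeI (curv h k e x) (fun c => 0 <= c) U V) <->
  exists (f : r.-tuple (E x)) (N1 N2 : nat)
    (B : 'M[form1 R n]_(r, N2)) (A : 'M[form1 R n]_(r, N1)),
    curvature_factorization h k e f B A.
Proof.
split=> [[U [V typ]]|[f [N1 [N2 [B [A BA]]]]]].
  have [f uf] := unitary_frame_exists h (fsec_basis ex).
  have typf := typeI_frame (change_basis_unit uf) typ.
  have [N1 [N2 [c [b [bV cU Tf]]]]] :=
    typeI_factor (tensor_herm_frame _ (curv_herm h hk kx he ex)) typf.
  exists f, N1, N2, (conj_forms (forms10 b)), (forms10 c).
  apply/curvature_factorizationP; split=> //.
  by exists U, V; split=> //; case: typ.
have [_ [/forms01P[b bE] /forms10P[c cE]] _ _] := BA.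
move: BA; rewrite bE cE => /curvature_factorizationP[uf Tf [U [V [UV bV cU]]]].
exists U, V; apply/(typeI_frameP _ _ _ _ (change_basis_unit uf)).
exact: factor_typeI Tf.
Qed.

Lemma positive_factorization :
  (exists U V, typeI (curv h k e x) (fun c => 0 < c) U V) <->
  exists (f : r.-tuple (E x)) (N1 N2 : nat)
    (B : 'M[form1 R n]_(r, N2)) (A : 'M[form1 R n]_(r, N1)),
    curvature_factorization h k e f B A /\
    exists U V : {vspace 'rV[C]_n},
    [/\ splitting U V,
        forall i p, annihilates V (conj_form (B i p)),
        forall i p, annihilates U (A i p)
      & exists (u : (\dim U).-tuple 'rV[C]_n) (v : (\dim V).-tuple 'rV[C]_n),
        [/\ basis_of U u, basis_of V v,
            \rank (coef_mx v A) = (r * \dim V)%N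
          & \rank (coef_mx_bar u B) = (r * \dim U)%N]].
Proof.
split=> [[U [V typ]]|[f [N1 [N2 [B [A [BA [U [V [UV BV AU [u [v [bu bv rA rB]]]]]]]]]]]]].
  have [f uf] := unitary_frame_exists h (fsec_basis ex).
  have typf := typeI_frame (change_basis_unit uf) typ.
  (* Non-negativity for the same splitting yields the factorization; positivity then makes it
     nondegenerate, which gives the ranks. *)
  have typ0 : typeI (tensor_frame (curv h k e x) (change_basis (fsec e x) f))
      (fun c => 0 <= c) U V.
    by case: typf => UV Upos cross Vpos; split=> // w Ww w0; apply: ltW;
       [exact: Upos|exact: Vpos].
  have [N1 [N2 [c [b [bV cU Tf]]]]] :=
    typeI_factor (tensor_herm_frame _ (curv_herm h hk kx he ex)) typ0.
  have [UV _ _ _] := typ0.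
  have [bU cV] := (factor_typeI_gt0 UV bV cU Tf).1 typf.
  exists f, N1, N2, (conj_forms (forms10 b)), (forms10 c); split.
    by apply/curvature_factorizationP; split=> //; exists U, V.
  exists U, V; split=> //.
  - move=> i p; rewrite mxE conj_formK; exact: ((annihilates10P b V).2 bV).
  - exact: ((annihilates10P c U).2 cU).
  - exists (vbasis U), (vbasis V); split; do ?exact: vbasisP.
      exact/(rank_coef_mx _ (vbasisP V)).
    exact/(rank_coef_mx_bar _ (vbasisP U)).
have [_ [/forms01P[b bE] /forms10P[c cE]] _ _] := BA.
rewrite {}bE {}cE in BA BV AU rA rB.
have [uf Tf _] := (curvature_factorizationP _ _ _).1 BA.
(* This is the given splitting, to which the rank conditions refer. *)
exists U, V; apply/(typeI_frameP _ _ _ _ (change_basis_unit uf)).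
apply/(factor_typeI_gt0 UV _ _ Tf).
- by apply/annihilates10P => i p; have := BV i p; rewrite mxE conj_formK.
- exact/annihilates10P.
- by split; [exact/(rank_coef_mx_bar _ bu)|exact/(rank_coef_mx _ bv)].
Qed.

End Factorization.

(** * From points to the whole manifold *)

Lemma decomposably_typeIP (R : realType) (n r : nat) (X : complex_manifold R n)
    (E : holo_bundle X r) (h : hermitian_metric E) (pos : complex R -> Prop) :
  decomposably_typeI h pos <->
  forall (x : X) (k : chart R n X) (e : local_frame r E),
  holo_chart k -> cdom k x -> holo_frame e -> fdom e x ->
  exists U V, typeI (curv h k e x) pos U V.
Proof.
split=> H x k e hk kx he ex; have [U [V [UV Upos cross Vpos]]] := H x k e hk kx he ex;
  exists U, V; split=> // v Vv v0.
  by rewrite tensor_form_trE; exact: Vpos.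
by have := Vpos v Vv v0; rewrite tensor_form_trE.
Qed.

Theorem theorem4p3 (R : realType) (n r : nat) (X : complex_manifold R n)
    (E : holo_bundle X r) (h : hermitian_metric E) :
  (strongly_decomposably_nonnegative_I h <->
   forall (x : X) (k : chart R n X) (e : local_frame r E),
   holo_chart k -> cdom k x -> holo_frame e -> fdom e x ->
   exists (f : r.-tuple (E x)) (N1 N2 : nat)
     (B : 'M[form1 R n]_(r, N2)) (A : 'M[form1 R n]_(r, N1)),
     curvature_factorization h k e f B A)
  /\
  (strongly_decomposably_positive_I h <->
   forall (x : X) (k : chart R n X) (e : local_frame r E),
   holo_chart k -> cdom k x -> holo_frame e -> fdom e x ->
   exists (f : r.-tuple (E x)) (N1 N2 : nat)
     (B : 'M[form1 R n]_(r, N2)) (A : 'M[form1 R n]_(r, N1)),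
     curvature_factorization h k e f B A /\
     exists U V : {vspace 'rV[complex R]_n},
     [/\ splitting U V,
         forall i p, annihilates V (conj_form (B i p)),
         forall i p, annihilates U (A i p)
       & exists (u : (\dim U).-tuple 'rV[complex R]_n)
                (v : (\dim V).-tuple 'rV[complex R]_n),
         [/\ basis_of U u, basis_of V v,
             \rank (coef_mx v A) = (r * \dim V)%N
           & \rank (coef_mx_bar u B) = (r * \dim U)%N]]).
Proof.
split; apply: iff_trans (decomposably_typeIP h _) _;
  split=> H x k e hk kx he ex; have := H x k e hk kx he ex.
- by move/(nonnegative_factorization h hk kx he ex).
- by move/(nonnegative_factorization h hk kx he ex).
- by move/(positive_factorization h hk kx he ex).
- by move/(positive_factorization h hk kx he ex).
Qed.
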